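(* Let $n\ge2$, let $A=\mathcal O_n$ be the Cuntz algebra with generating Cuntz family $S_1,\dots,S_n$, and let $\alpha(x)=\sum_{i=1}^nS_ixS_i^*$ for $x\in A$ (a unital injective $*$-endomorphism of $A$). Then: (a) the canonical $*$-epimorphism $A\times_\alpha^n\mathbb N\to A_\infty\rtimes_{\alpha_\infty}\mathcal O_n$ is not injective; (b) the canonical homomorphism $A\times_\alpha\mathcal T_n^+\to A_\infty\rtimes_{\alpha_\infty}\mathcal O_n$ is completely contractive but not completely isometric; (c) $A\times_\alpha\mathcal T_n^+$ and $A\times_\alpha^t\mathcal T_n^+$ are not completely isometrically isomorphic via the canonical map.
   Context: A Toeplitz-Cuntz family is a family of isometries $T_1,\dots,T_n$ with $\sum_iT_iT_i^*\le I$; it is a Cuntz family if equality holds. For a word $\mu=i_1\cdots i_k$ in the free semigroup $\mathbb F_n^+$, $T_\mu=T_{i_1}\cdots T_{i_k}$, $|\mu|=k$. Consider pairs $(\pi,\{T_i\})$ with $\pi$ a unital $*$-representation of $A$, $\{T_i\}$ a Toeplitz-Cuntz family on the same space, and $\pi(\alpha(x))=\sum_iT_i\pi(x)T_i^*$ for all $x\in A$ (since $\alpha$ is unital, representations are taken unital by convention). $A\times_\alpha^n\mathbb N$ is the universal $C^*$-algebra generated by $\pi(A)$ and $\{T_i\}$ over such pairs, and $A\times_\alpha\mathcal T_n^+$ is the universal norm-closed non-selfadjoint operator algebra generated by $\pi(x)$, $T_\mu$ over such pairs. $A\times_\alpha^t\mathcal T_n^+$ is the universal norm-closed non-selfadjoint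 operator algebra generated by $\pi(x)\otimes I$ and $S^{|\mu|}\otimes T_\mu$ over triples $(\pi,S,\{T_i\})$ with $\pi:A\to\mathcal B(H_1)$ a unital $*$-representation, $S\in\mathcal B(H_1)$ an isometry with $S\pi(x)=\pi(\alpha(x))S$, and $\{T_i\}\subseteq\mathcal B(H_2)$ a Toeplitz-Cuntz family. $A_\infty$ is the $C^*$-direct limit of $A\xrightarrow{\alpha}A\xrightarrow{\alpha}\cdots$ with induced automorphism $\alpha_\infty$. The twisted crossed product $A_\infty\rtimes_{\alpha_\infty}\mathcal O_n$ is the $C^*$-subalgebra of $(A_\infty\rtimes_{\alpha_\infty}\mathbb Z)\otimes\mathcal O_n$ generated by $\sigma(A_\infty)\otimes I$ and the Cuntz family $\{U\otimes T_i\}$, where $(\sigma,U)$ is the universal unitary covariant pair and $\{T_i\}$ generates $\mathcal O_n$. Canonical maps send generators to generators of the same index: $\pi(x)\mapsto\sigma(x)\otimes I$ (with $A\subseteq A_\infty$) or $\pi(x)\otimes I$, and $T_i\mapsto U\otimes T_i$ or $S\otimes T_i$. *)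

(* Defs.v *)
From HB Require Import structures.
From mathcomp Require Import all_boot all_order all_algebra.
From mathcomp Require Import complex.
From mathcomp Require Import all_classical all_reals all_analysis.

Set Implicit Arguments.
Unset Strict Implicit.
Unset Printing Implicit Defensive.

Import Order.TTheory GRing.Theory Num.Theory.
Import numFieldNormedType.Exports.

Local Open Scope classical_set_scope.
Local Open Scope ring_scope.
Local Open Scope complex_scope.

(* Norms of vectors take values in R[i] (as nonnegative reals of R[i]), which
   is the library's convention for normed modules over R[i].  The inner
   product is linear in its first argument. *)
HB.mixin Record CompleteNormedModule_isHilbert (R : realType) V
    of CompleteNormedModule R[i] V := {
  hdot : V -> V -> R[i] ;
  hdot_linear : forall (c : R[i]) (x y z : V),
    hdot (c *: x + y) z = c * hdot x z + hdot y z ;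
  hdotC : forall x y : V, hdot y x = (hdot x y)^* ;
  hdot_norm : forall x : V, hdot x x = `|x| ^+ 2
}.

#[short(type="hilbertType")]
HB.structure Definition Hilbert (R : realType) :=
  {V of CompleteNormedModule R[i] V & CompleteNormedModule_isHilbert R V}.

Notation "''[' x , y ]" := (hdot x y) : ring_scope.

(* Index sets for generating families: the elements of A together with all
   indices in I. *)
Definition with_gens T (A : set T) I : set (T + I) :=
  [set j | if j is inl x then A x else True].
Arguments with_gens {T} A I.

(* Operators on H are functions H -> H with their pointwise linear structure
   and the product \o; [bounded_ops H] is B(H).  All C*-algebras and operator
   algebras below are concrete, i.e. sets of bounded operators. *)
Section Operators.
Context {R : realType}.
Implicit Types H K Hinf : hilbertType R.

Definition bounded_ops H : set (H -> H) :=
  [set f | (forall (c : R[i]) (x y : H), f (c *: x + y) = c *: f x + f y)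
           /\ continuous f].

Definition is_adjoint H (f g : H -> H) : Prop :=
  forall x y, '[f x, y] = '[x, g y].

(* The adjoint of f, which exists and is unique for f in B(H); the value is
   immaterial for other functions. *)
Definition adj H (f : H -> H) : H -> H := xget 0 [set g | is_adjoint f g].

(* f <= g in the operator order: g - f is positive.  A number c : R[i]
   satisfies 0 <= c iff it is real and nonnegative. *)
Definition op_le H (f g : H -> H) : Prop := forall x, 0 <= '[(g - f) x, x].

Definition isometry H (f : H -> H) : Prop :=
  bounded_ops f /\ forall x, `|f x| = `|x|.

Definition unitary H (f : H -> H) : Prop :=
  [/\ bounded_ops f, adj f \o f = id & f \o adj f = id].

(* Norm of a k-tuple in the Hilbert space H^k. *)
Definition tuple_norm H k (xi : 'I_k -> H) : R :=
  Num.sqrt (\sum_(i < k) (complex.Re `|xi i|) ^+ 2).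

(* Norm of a k x k matrix of operators, acting on H^k. *)
Definition mx_opnorm H k (a : 'M[H -> H]_k) : R :=
  sup [set r | exists xi : 'I_k -> H,
    tuple_norm xi <= 1 /\ r = tuple_norm (fun i => \sum_j a i j (xi j))].

Definition opnorm H (f : H -> H) : R :=
  sup [set r | exists x : H, `|x| <= 1 /\ r = complex.Re `|f x|].

Definition operator_algebra H (A : set (H -> H)) : Prop :=
  [/\ A `<=` bounded_ops (H := H),
      A 0,
      forall (c : R[i]) a b, A a -> A b -> A (c *: a + b),
      forall a b, A a -> A b -> A (a \o b) &
      forall a, bounded_ops a ->
        (forall e : R, 0 < e -> exists b, A b /\ opnorm (a - b) < e) -> A a].

Definition cstar_algebra H (A : set (H -> H)) : Prop :=
  operator_algebra A /\ forall a, A a -> A (adj a).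

Definition alg_hom H K (A : set (H -> H)) (B : set (K -> K))
    (Phi : (H -> H) -> (K -> K)) : Prop :=
  [/\ set_fun A B Phi,
      forall (c : R[i]) a b, A a -> A b ->
        Phi (c *: a + b) = c *: Phi a + Phi b &
      forall a b, A a -> A b -> Phi (a \o b) = Phi a \o Phi b].

Definition star_hom H K (A : set (H -> H)) (B : set (K -> K))
    (Phi : (H -> H) -> (K -> K)) : Prop :=
  alg_hom A B Phi /\ forall a, A a -> Phi (adj a) = adj (Phi a).

Definition unital_rep H K (A : set (H -> H)) (pi : (H -> H) -> (K -> K)) :=
  star_hom A (bounded_ops (H := K)) pi /\ pi id = id.

Definition completely_contractive H K (A : set (H -> H))
    (Phi : (H -> H) -> (K -> K)) : Prop :=
  forall k (a : 'M[H -> H]_k), (forall i j, A (a i j)) ->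
    mx_opnorm (map_mx Phi a) <= mx_opnorm a.

Definition completely_isometric H K (A : set (H -> H))
    (Phi : (H -> H) -> (K -> K)) : Prop :=
  forall k (a : 'M[H -> H]_k), (forall i j, A (a i j)) ->
    mx_opnorm (map_mx Phi a) = mx_opnorm a.

(* The C*-algebra, resp. norm-closed algebra, generated by the family of
   operators (u j) with j in J. *)
Definition cstar_gen I (J : set I) H (u : I -> H -> H) : set (H -> H) :=
  smallest (@cstar_algebra H) (u @` J).

Definition opalg_gen I (J : set I) H (u : I -> H -> H) : set (H -> H) :=
  smallest (@operator_algebra H) (u @` J).

Definition intertwines I (J : set I) H K (u : I -> H -> H) (v : I -> K -> K)
    (Phi : (H -> H) -> (K -> K)) : Prop :=
  forall j, J j -> Phi (u j) = v j.

(* A class P of families of operators indexed by J, on varying Hilbert spaces,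
   and a family u of the class which is universal in it: every family of the
   class is the image of u under a *-homomorphism of the generated C*-algebra,
   resp. under a completely contractive homomorphism of the generated
   norm-closed algebra.  As u is itself in the class, the norms (in the second
   case the matrix norms) of the algebra generated by u are the suprema over the
   class, so this algebra is a faithful copy of the universal algebra. *)
Definition cstar_universal I (J : set I)
    (P : forall H : hilbertType R, (I -> H -> H) -> Prop)
    H (u : I -> H -> H) : Prop :=
  P H u /\
  forall K (v : I -> K -> K), P K v ->
    exists Phi, star_hom (cstar_gen J u) (bounded_ops (H := K)) Phi /\
                intertwines J u v Phi.

Definition opalg_universal I (J : set I)
    (P : forall H : hilbertType R, (I -> H -> H) -> Prop)
    H (u : I -> H -> H) : Prop :=
  P H u /\
  forall K (v : I -> K -> K), P K v ->
    exists Phi, [/\ alg_hom (opalg_gen J u) (bounded_ops (H := K)) Phi,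
                    completely_contractive (opalg_gen J u) Phi &
                    intertwines J u v Phi].

Definition toeplitz_cuntz n H (T : 'I_n -> H -> H) : Prop :=
  (forall i, isometry (T i)) /\ op_le (\sum_(i < n) (T i \o adj (T i))) id.

Definition cuntz n H (T : 'I_n -> H -> H) : Prop :=
  (forall i, isometry (T i)) /\ \sum_(i < n) (T i \o adj (T i)) = id.

(* The Cuntz algebra O_n, as the C*-algebra generated by T, is the universal
   C*-algebra of a Cuntz family.  Nontriviality of H follows from this for
   n >= 1 (nonzero Cuntz families exist); it is spelled out for convenience. *)
Definition cuntz_generators n H (T : 'I_n -> H -> H) : Prop :=
  cstar_universal setT (fun K => @cuntz n K) T /\ exists x : H, x != 0.

Definition cuntz_algebra n H (T : 'I_n -> H -> H) : set (H -> H) :=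
  cstar_gen setT T.

Definition cuntz_endo n H (S : 'I_n -> H -> H) (x : H -> H) : H -> H :=
  \sum_(i < n) (S i \o x \o adj (S i)).

Definition word n H (T : 'I_n -> H -> H) (mu : seq 'I_n) : H -> H :=
  foldr (fun i f => T i \o f) id mu.

(* A structure exhibiting K as the Hilbert space tensor product of H1 and H2.
   Bilinearity of tensor_vec follows from tensor_vec_dot.  For bounded a and b
   the bounded operator tensor_op a b exists and is uniquely determined by
   tensor_op_vec, as simple tensors span a dense subspace; its value is
   immaterial otherwise. *)
Record hilbert_tensor (H1 H2 K : hilbertType R) := HilbertTensor {
  tensor_vec : H1 -> H2 -> K ;
  tensor_op : (H1 -> H1) -> (H2 -> H2) -> (K -> K) ;
  tensor_vec_dot : forall x x' y y',
    '[tensor_vec x y, tensor_vec x' y'] = '[x, x'] * '[y, y'] ;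
  tensor_vec_dense :
    dense [set \sum_(p <- s) tensor_vec p.1 p.2 | s in [set: seq (H1 * H2)]] ;
  tensor_op_bounded : forall a b, bounded_ops a -> bounded_ops b ->
    bounded_ops (tensor_op a b) ;
  tensor_op_vec : forall a b, bounded_ops a -> bounded_ops b ->
    forall x y, tensor_op a b (tensor_vec x y) = tensor_vec (a x) (b y)
}.

Section Dynamics.
Variables (n : nat) (H0 : hilbertType R).
Variables (A : set (H0 -> H0)) (alpha : (H0 -> H0) -> (H0 -> H0)).

Definition covariant_pair H (pi : (H0 -> H0) -> (H -> H))
    (T : 'I_n -> H -> H) : Prop :=
  [/\ unital_rep A pi, toeplitz_cuntz T &
      forall x, A x ->
        pi (alpha x) = \sum_(i < n) (T i \o pi x \o adj (T i))].

Definition pair_gens I H (pi : (H0 -> H0) -> (H -> H)) (V : I -> H -> H)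
    (j : (H0 -> H0) + I) : H -> H :=
  match j with inl x => pi x | inr i => V i end.

Definition covariant_gens H (u : (H0 -> H0) + 'I_n -> H -> H) : Prop :=
  exists pi T, covariant_pair pi T /\ u = pair_gens pi T.

Definition covariant_word_gens H (u : (H0 -> H0) + seq 'I_n -> H -> H) :=
  exists pi T, covariant_pair pi T /\ u = pair_gens pi (word T).

Definition covariant_triple H1 H2 (pi : (H0 -> H0) -> (H1 -> H1))
    (S : H1 -> H1) (T : 'I_n -> H2 -> H2) : Prop :=
  [/\ unital_rep A pi, isometry S,
      forall x, A x -> S \o pi x = pi (alpha x) \o S & toeplitz_cuntz T].

Definition tensor_word_gens H (u : (H0 -> H0) + seq 'I_n -> H -> H) :=
  exists (H1 H2 : hilbertType R) (t : hilbert_tensor H1 H2 H) pi S T,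
    covariant_triple pi S T /\
    u = pair_gens (fun x => tensor_op t (pi x) id)
          (fun mu => tensor_op t (iter (size mu) S) (word T mu)).

(* u realizes A x_alpha^n N as cstar_gen (with_gens A 'I_n) u. *)
Definition universal_covariant H (u : (H0 -> H0) + 'I_n -> H -> H) :=
  cstar_universal (with_gens A 'I_n) covariant_gens u.

(* u realizes A x_alpha T_n^+ as opalg_gen (with_gens A (seq 'I_n)) u. *)
Definition universal_semicrossed H (u : (H0 -> H0) + seq 'I_n -> H -> H) :=
  opalg_universal (with_gens A (seq 'I_n)) covariant_word_gens u.

(* u realizes A x_alpha^t T_n^+ as opalg_gen (with_gens A (seq 'I_n)) u. *)
Definition universal_tensor_semicrossed H
    (u : (H0 -> H0) + seq 'I_n -> H -> H) :=
  opalg_universal (with_gens A (seq 'I_n)) tensor_word_gens u.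

(* Cocones on A --alpha--> A --alpha--> ...; the index (k, x) stands for the
   element x of the k-th copy of A. *)
Definition cocone H (u : nat * (H0 -> H0) -> H -> H) : Prop :=
  forall k, unital_rep A (fun x => u (k, x)) /\
            forall x, A x -> u (k.+1, alpha x) = u (k, x).

Definition direct_limit_index : set (nat * (H0 -> H0)) := [set j | A j.2].

Definition is_direct_limit Hinf (iota : nat * (H0 -> H0) -> Hinf -> Hinf) :=
  cstar_universal direct_limit_index cocone iota.

Definition direct_limit Hinf (iota : nat * (H0 -> H0) -> Hinf -> Hinf) :
  set (Hinf -> Hinf) := cstar_gen direct_limit_index iota.

Definition induced_automorphism Hinf
    (iota : nat * (H0 -> H0) -> Hinf -> Hinf)
    (alphainf : (Hinf -> Hinf) -> (Hinf -> Hinf)) : Prop :=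
  [/\ star_hom (direct_limit iota) (direct_limit iota) alphainf,
      set_bij (direct_limit iota) (direct_limit iota) alphainf &
      forall k x, A x -> alphainf (iota (k, x)) = iota (k, alpha x)].

End Dynamics.

(* Unitary covariant pairs (sigma, U) of an automorphism beta of B, and the
   universal one, for which C*(sigma, U) is the crossed product of B by Z. *)
Definition unitary_pair H0 (B : set (H0 -> H0))
    (beta : (H0 -> H0) -> (H0 -> H0)) H
    (u : (H0 -> H0) + unit -> H -> H) : Prop :=
  exists sigma U,
    [/\ unital_rep B sigma, unitary U,
        forall x, B x -> U \o sigma x \o adj U = sigma (beta x) &
        u = pair_gens sigma (fun=> U)].

Definition universal_unitary_pair H0 (B : set (H0 -> H0))
    (beta : (H0 -> H0) -> (H0 -> H0)) H
    (sigma : (H0 -> H0) -> (H -> H)) (U : H -> H) : Prop :=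
  cstar_universal (with_gens B unit) (unitary_pair B beta)
    (pair_gens sigma (fun=> U)).

(* The twisted crossed product of B by O_n, inside C*(sigma, U) tensor C*(T)
   acting on K. *)
Definition twisted_crossed n H0 (B : set (H0 -> H0)) H1 H2 K
    (t : hilbert_tensor H1 H2 K) (sigma : (H0 -> H0) -> (H1 -> H1))
    (U : H1 -> H1) (T : 'I_n -> H2 -> H2) : set (K -> K) :=
  cstar_gen (with_gens B 'I_n)
    (pair_gens (fun x => tensor_op t (sigma x) id)
               (fun i => tensor_op t U (T i))).

End Operators.

Arguments bounded_ops {R} H.

(* Main.v *)
From HB Require Import structures.
Require Import Defs.
From mathcomp Require Import all_boot all_order all_algebra.
From mathcomp Require Import complex.
From mathcomp Require Import all_classical all_reals all_analysis.
From mathcomp Require Import ring lra.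

(** In the pair (id, S) on H0 the operators pi(S_i) and T_i coincide, whereas
    in every representation through a tensor product the T_i = U (x) T_i carry
    orthogonality that no element of A can undo.

    (a) T_0^* pi(S_0 S_1^* ) T_1 is the identity in the pair (id, S), but equals
    U^* sigma(S_0 S_1^* ) U (x) T_0^* T_1 = 0 in the twisted crossed product.
    Surjectivity needs that a *-homomorphism pi has closed range: if pi(a) is a
    contraction, a (1 + a^* a)^-1 has norm at most 1/2 and lifts pi(a) up to an
    error of norm at most 1/2, so that an element of the closure is the image
    of a convergent series; the inverse is a Neumann series.

    (b), (c) sum_i pi(S_i^* ) T_i is n times the identity in the pair (id, S),
    so its norm in the universal algebra is at least n; but
    sum_i pi(S_i^* ) V (x) T_i is an isometry for each isometry V and each
    Toeplitz-Cuntz family T. *)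

Set Implicit Arguments.
Unset Strict Implicit.
Unset Printing Implicit Defensive.

Import Order.TTheory GRing.Theory Num.Theory.
Import numFieldNormedType.Exports.

Local Open Scope classical_set_scope.
Local Open Scope ring_scope.
Local Open Scope complex_scope.

(* Importing all_algebra shadows Defs.isometry by another notion. *)
Local Notation isometry := Defs.isometry.

(** * Hilbert spaces *)

Section HilbertSpace.
Context {R : realType}.
Implicit Types H K : hilbertType R.

(** The witness for (a) involves T_0^*, which is not among the generators of the non-selfadjoint
    algebra; the one for (b) and (c) takes all its adjoints from A, so it lives in that algebra
    already.

    A homomorphism supplied by a universal property is known only on generators and lands a priori
    in all of B(K). Locating its range is an induction over a generated norm-closed algebra, and the
    closure step of that induction asks for contractivity; reaching every element of the twisted
    crossed product asks in addition that the range be closed.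

    For *-homomorphisms both facts are obtained from two elementary tools. Inverses are Neumann
    series, and the place of square roots and functional calculus is taken by the inequality P^2 <=
    m^2 P for P = m^2 - f^* f with f bounded by m, a direct computation with norms of vectors. *)

Definition rnorm H (x : H) : R := complex.Re `|x|.

(** Estimates run on real parts, where [lra] and [nra] apply. Nothing is lost: the imaginary part of
    the inner product at x is minus the real part at ['i *: x]. *)
Definition rdot H (x y : H) : R := complex.Re '[x, y].

Lemma normE H (x : H) : `|x| = (rnorm x)%:C.
Proof. by rewrite /rnorm RRe_real // ger0_real. Qed.

Lemma hdotDl H (x y z : H) : '[x + y, z] = '[x, z] + '[y, z].
Proof. by have := hdot_linear 1 x y z; rewrite scale1r mul1r. Qed.

Lemma hdot0l H (z : H) : '[0, z] = 0.
Proof. by apply: (addrI '[0, z]); rewrite -hdotDl !addr0. Qed.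

Lemma hdotZl H c (x z : H) : '[c *: x, z] = c * '[x, z].
Proof. by have := hdot_linear c x 0 z; rewrite addr0 hdot0l addr0. Qed.

Lemma rdotDl H (x y z : H) : rdot (x + y) z = rdot x z + rdot y z.
Proof. by rewrite /rdot hdotDl; case: '[x, z]; case: '[y, z]. Qed.

Lemma rdotC H (x y : H) : rdot x y = rdot y x.
Proof. by rewrite /rdot hdotC; case: '[y, x]. Qed.

Lemma rdotDr H (x y z : H) : rdot z (x + y) = rdot z x + rdot z y.
Proof. by rewrite rdotC rdotDl !(rdotC z). Qed.

Lemma rdotZl H (r : R) (x z : H) : rdot (r%:C *: x) z = r * rdot x z.
Proof.
by rewrite /rdot hdotZl; case: '[x, z] => a b /=; rewrite mul0r subr0.
Qed.

Lemma rdotZr H (r : R) (x z : H) : rdot z (r%:C *: x) = r * rdot z x.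
Proof. by rewrite rdotC rdotZl rdotC. Qed.

Lemma rdotNl H (x z : H) : rdot (- x) z = - rdot x z.
Proof.
have -> : - x = (-1)%:C *: x by rewrite rmorphN rmorph1 scaleN1r.
by rewrite rdotZl mulN1r.
Qed.

Lemma rdotNr H (x z : H) : rdot z (- x) = - rdot z x.
Proof. by rewrite rdotC rdotNl rdotC. Qed.

Lemma rdot0l H (z : H) : rdot 0 z = 0.
Proof. by rewrite /rdot hdot0l. Qed.

Lemma rdotiZl H (x z : H) : rdot ('i *: x) z = - complex.Im '[x, z].
Proof.
by rewrite /rdot hdotZl; case: '[x, z] => a b /=; rewrite mul0r mul1r sub0r.
Qed.

Lemma rdot_suml H I (r : seq I) P (F : I -> H) z :
  rdot (\sum_(i <- r | P i) F i) z = \sum_(i <- r | P i) rdot (F i) z.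
Proof.
apply: (big_morph (fun x => rdot x z)); last exact: rdot0l.
by move=> x y; rewrite rdotDl.
Qed.

Lemma hdot_suml H I (r : seq I) P (F : I -> H) z :
  '[\sum_(i <- r | P i) F i, z] = \sum_(i <- r | P i) '[F i, z].
Proof.
apply: (big_morph (fun x => '[x, z])); last exact: hdot0l.
by move=> x y; rewrite hdotDl.
Qed.

Lemma hdot_sumr H I (r : seq I) P (F : I -> H) z :
  '[z, \sum_(i <- r | P i) F i] = \sum_(i <- r | P i) '[z, F i].
Proof.
rewrite hdotC hdot_suml rmorph_sum /=.
by apply: eq_bigr => i _; rewrite -hdotC.
Qed.

Lemma rnorm_ge0 H (x : H) : 0 <= rnorm x.
Proof. by rewrite -ler0c -normE. Qed.

Lemma rdotxx H (x : H) : rdot x x = rnorm x ^+ 2.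
Proof. by rewrite /rdot hdot_norm normE -rmorphXn. Qed.

Lemma ler_rnormD H (x y : H) : rnorm (x + y) <= rnorm x + rnorm y.
Proof. by rewrite -lecR rmorphD /= -!normE ler_normD. Qed.

Lemma rnormZ H c (x : H) : rnorm (c *: x) = complex.Re `|c| * rnorm x.
Proof. by rewrite /rnorm normrZ normE normc_def -rmorphM. Qed.

Lemma rnormZr H (r : R) (x : H) : rnorm (r%:C *: x) = `|r| * rnorm x.
Proof. by rewrite rnormZ normc_def /= expr0n addr0 sqrtr_sqr. Qed.

Lemma rnormN H (x : H) : rnorm (- x) = rnorm x.
Proof. by rewrite /rnorm normrN. Qed.

Lemma rnorm0 H : rnorm (0 : H) = 0.
Proof. by rewrite /rnorm normr0. Qed.

Lemma rnormB H (x y : H) : rnorm (x - y) = rnorm (y - x).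
Proof. by rewrite -rnormN opprB. Qed.

Lemma rnorm0_eq0 H (x : H) : rnorm x = 0 -> x = 0.
Proof. by move=> x0; apply/normr0_eq0; rewrite normE x0. Qed.

Lemma rnorm_gt0 H (x : H) : (0 < rnorm x) = (x != 0).
Proof. by rewrite -ltcR -normE normr_gt0. Qed.

(** The triangle inequality comes with the normed module, so Cauchy-Schwarz is read off by squaring
    it. *)
Lemma ler_rdot H (x y : H) : rdot x y <= rnorm x * rnorm y.
Proof.
have h := ler_rnormD x y.
have : rnorm (x + y) ^+ 2 <= (rnorm x + rnorm y) ^+ 2.
  by rewrite lerXn2r // nnegrE ?addr_ge0 ?rnorm_ge0.
rewrite -rdotxx rdotDl !rdotDr (rdotC y x) !rdotxx sqrrD mulr2n.
lra.
Qed.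

Lemma ler_abs_rdot H (x y : H) : `|rdot x y| <= rnorm x * rnorm y.
Proof.
rewrite ler_norml ler_rdot andbT lerNl -rdotNl.
by rewrite (le_trans (ler_rdot _ _)) // rnormN.
Qed.

Lemma ler_rnorm_sqr H (x : H) (M : R) : 0 <= M -> rdot x x <= M ^+ 2 -> rnorm x <= M.
Proof.
by move=> M0; rewrite rdotxx ler_pXn2r ?nnegrE ?rnorm_ge0.
Qed.

Lemma rdot_eq H (x y : H) : (forall z, rdot x z = rdot y z) -> x = y.
Proof.
move=> h; apply/subr0_eq/rnorm0_eq0/eqP; rewrite -sqrf_eq0 -rdotxx.
by rewrite rdotDl rdotNl h subrr.
Qed.

Lemma rnorm_cauchy_cvg H (u : nat -> H) :
  (forall e : R, 0 < e -> exists N, forall i j, (N <= i)%N -> (N <= j)%N ->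
    rnorm (u i - u j) < e) ->
  exists l, forall e : R, 0 < e -> exists N, forall i, (N <= i)%N ->
    rnorm (u i - l) < e.
Proof.
move=> hu.
have /cauchy_cvgP : cauchy (u @ \oo).
  apply/cauchy_ballP => e e0.
  have /hu [N hN] : 0 < complex.Re e by move: e0; rewrite ltcE /= => /andP[].
  have eE : e = (complex.Re e)%:C by rewrite RRe_real // gtr0_real.
  rewrite near_map2; near=> i j; rewrite -ball_normE /= normE eE ltcR.
  by apply: hN; [near: i|near: j]; exists N.
move=> /cvg_ex[l /cvgrPdist_lt hl]; exists l => e e0.
have [N _ hN] := hl e%:C ltac:(by rewrite ltcR).
exists N => i Ni; rewrite rnormB -ltcR -normE; exact: hN.
Unshelve. all: by end_near.
Qed.

Definition linear_op H K (f : H -> K) := forall (c : R[i]) x y,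
  f (c *: x + y) = c *: f x + f y.

Lemma linear_opD H K (f : H -> K) : linear_op f -> {morph f : x y / x + y}.
Proof. by move=> lf x y; have := lf 1 x y; rewrite !scale1r. Qed.

Lemma linear_op0 H K (f : H -> K) : linear_op f -> f 0 = 0.
Proof.
by move=> lf; apply: (addrI (f 0)); rewrite -linear_opD // !addr0.
Qed.

Lemma linear_opZ H K (f : H -> K) : linear_op f ->
  forall c x, f (c *: x) = c *: f x.
Proof. by move=> lf c x; have := lf c x 0; rewrite (linear_op0 lf) !addr0. Qed.

Lemma linear_opN H K (f : H -> K) : linear_op f -> {morph f : x / - x}.
Proof. by move=> lf x; rewrite -scaleN1r linear_opZ // scaleN1r. Qed.

Lemma linear_opB H K (f : H -> K) : linear_op f -> {morph f : x y / x - y}.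
Proof. by move=> lf x y; rewrite linear_opD // linear_opN. Qed.

Lemma linear_op_sum H K (f : H -> K) I (r : seq I) P (F : I -> H) :
  linear_op f -> f (\sum_(i <- r | P i) F i) = \sum_(i <- r | P i) f (F i).
Proof.
by move=> lf; apply: (big_morph f); [exact: linear_opD|exact: linear_op0].
Qed.

Definition norm_bound H K (f : H -> K) (M : R) :=
  forall x, rnorm (f x) <= M * rnorm x.

Lemma bounded_opsP H (f : H -> H) :
  bounded_ops H f <-> linear_op f /\ exists M, norm_bound f M.
Proof.
split=> [[lf cf]|[lf [M hM]]]; split=> //.
  have /cvgrPdist_lt /(_ 1 ltr01) := cf 0.
  move=> /nbhs_normP[d /= d0 hd].
  have dE : d = (complex.Re d)%:C by rewrite RRe_real // gtr0_real.
  set r := complex.Re d in dE.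
  have r0 : 0 < r by rewrite -ltcR -dE.
  exists (2 / r) => x.
  have [->|x0] := eqVneq x 0; first by rewrite linear_op0 // !rnorm0 mulr0.
  rewrite -rnorm_gt0 in x0.
  (* The factor 2 gives [s%:C *: x] the norm r / 2, strictly inside the ball on which f stays below
     1. *)
  pose s := r / (2 * rnorm x).
  have s0 : 0 < s by rewrite divr_gt0 // mulr_gt0.
  have : rnorm (f (s%:C *: x)) < 1.
    rewrite -ltcR -normE; have := hd (s%:C *: x).
    rewrite /= sub0r linear_op0 // sub0r !normrN; apply.
    rewrite normE dE ltcR rnormZr gtr0_norm // /s.
    rewrite invfM -!mulrA mulVf ?mulr1 ?gt_eqF //.
    by rewrite gtr_pMr // invf_lt1 ?ltr1n.
  rewrite linear_opZ // rnormZr gtr0_norm // /s => /ltW.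
  rewrite mulrC -ler_pdivlMr ?divr_gt0 ?mulr_gt0 //.
  by rewrite invfM invrK mul1r mulrC mulrAC.
move=> x; apply/cvgrPdist_lt => e e0.
have eE : e = (complex.Re e)%:C by rewrite RRe_real // gtr0_real.
set r := complex.Re e in eE.
have r0 : 0 < r by rewrite -ltcR -eE.
(* M may be zero or negative, hence the positive bound |M| + 1. *)
apply/nbhs_normP; exists (r / (`|M| + 1))%:C => /=.
  by rewrite ltcR divr_gt0 // ltr_wpDl.
move=> y; rewrite /ball_ /= !normE eE !ltcR -linear_opB // => hxy.
rewrite (le_lt_trans (hM _)) //.
apply: (@le_lt_trans _ _ ((`|M| + 1) * rnorm (x - y))).
  by rewrite ler_wpM2r ?rnorm_ge0 // (le_trans (ler_norm _)) // lerDl.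
by rewrite mulrC -ltr_pdivlMr // ltr_wpDl.
Qed.

Lemma bounded_linear H (f : H -> H) : bounded_ops H f -> linear_op f.
Proof. by case. Qed.

Lemma bounded_norm_bound H (f : H -> H) : bounded_ops H f ->
  exists2 M, 0 < M & norm_bound f M.
Proof.
move=> /bounded_opsP[_ [M hM]]; exists (`|M| + 1); first by rewrite ltr_wpDl.
move=> x; rewrite (le_trans (hM x)) // ler_wpM2r ?rnorm_ge0 //.
by rewrite (le_trans (ler_norm _)) // lerDl.
Qed.

Lemma norm_bound_bounded H (f : H -> H) M :
  linear_op f -> norm_bound f M -> bounded_ops H f.
Proof. by move=> lf hf; apply/bounded_opsP; split=> //; exists M. Qed.

End HilbertSpace.

(** * Adjoints and operator norms *)

Section Adjoint.
Context {R : realType}.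
Implicit Types H K : hilbertType R.

(** A nonnegative quadratic that vanishes at 0 has slope 0 there: for b > 0 its minimum, at t = -a /
    (2b), is -a^2 / (4b). For b <= 0 the values at 1 and -1 suffice. *)
Lemma le0_of_small_multiples (a b : R) : (forall t : R, 0 <= t * a + t ^+ 2 * b) ->
  a = 0.
Proof.
move=> h; have [b0|b0] := lerP b 0.
  have := h 1; have := h (-1); nra.
have := h (- a / (2 * b)).
have -> : - a / (2 * b) * a + (- a / (2 * b)) ^+ 2 * b = - (a ^+ 2 / (4 * b)).
  by field; lra.
rewrite oppr_ge0 pmulr_lle0 ?invr_gt0 ?mulr_gt0 // => h1.
by apply/eqP; rewrite -sqrf_eq0 eq_le h1 sqr_ge0.
Qed.

Lemma ler_addgt0 (x y : R) : (forall e : R, 0 < e -> x <= y + e) -> x <= y.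
Proof. by move=> h; apply/ler_addgt0Pr. Qed.

(* The representing vector minimizes |x|^2 - 2 psi(x); by the parallelogram
   law minimizing sequences are Cauchy. *)
Lemma riesz H (psi : H -> R) (M : R) :
  (forall x y, psi (x + y) = psi x + psi y) ->
  (forall (r : R) x, psi (r%:C *: x) = r * psi x) ->
  (forall x, psi x <= M * rnorm x) ->
  exists g, forall x, psi x = rdot x g.
Proof.
move=> psiD psiZ psiM.
pose J x := rdot x x - 2 * psi x.
have Jlb x : - M ^+ 2 <= J x.
  have := psiM x; rewrite /J rdotxx; have := sqr_ge0 (rnorm x - M).
  rewrite sqrrB; nra.
have infJ : has_inf (range J).
  split; first by exists (J 0), 0.
  by exists (- M ^+ 2) => _ [x _ <-].
set m := inf (range J).
have mJ x : m <= J x by apply: ge_inf; [case: infJ|exists x].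
have Jm (k : nat) : exists x, J x < m + (k.+1%:R)^-1.
  have k0 : 0 < k.+1%:R^-1 :> R by rewrite invr_gt0.
  have [_ [x _ <-] hx] := inf_adherent k0 infJ.
  by exists x.
have [u hu] := choice Jm.
have par x y : rnorm (x - y) ^+ 2 <= 2 * (J x - m) + 2 * (J y - m).
  have := mJ ((2^-1)%:C *: (x + y)).
  rewrite /J -rdotxx psiZ psiD !rdotZl !rdotZr.
  rewrite !(rdotDl, rdotDr, rdotNl, rdotNr) (rdotC y x); lra.
have invN (N i : nat) : (N <= i)%N -> i.+1%:R^-1 <= N.+1%:R^-1 :> R.
  by move=> Ni; rewrite lef_pV2 ?posrE ?ltr0n // ler_nat.
have smallN (e : R) : 0 < e -> exists N : nat, (N.+1%:R^-1 : R) < e.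
  move=> e0; exists (Num.truncn e^-1).
  by rewrite invf_plt ?posrE ?ltr0n // truncnS_gt.
have [g hg] : exists l, forall e : R, 0 < e -> exists N, forall i, (N <= i)%N ->
    rnorm (u i - l) < e.
  apply: rnorm_cauchy_cvg => e e0.
  have [N hN] := smallN (e ^+ 2 / 4) ltac:(by rewrite divr_gt0 // exprn_gt0).
  exists N => i j Ni Nj.
  rewrite -(@ltr_pXn2r _ 2) ?nnegrE ?rnorm_ge0 ?ltW //.
  have := par (u i) (u j); have := hu i; have := hu j.
  have := invN _ _ Ni; have := invN _ _ Nj; move: hN.
  move: (N.+1%:R^-1 : R) (i.+1%:R^-1 : R) (j.+1%:R^-1 : R) => *; lra.
exists g => z; apply/esym/subr0_eq.
(* First variation of J, taken at a minimizing u_i near g: half of J(u_i + t z) >= m > J(u_i) -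
   1/(i+1) is the required inequality up to two errors below e, one from replacing u_i by g and one
   from the gap to the infimum. *)
apply: (@le0_of_small_multiples _ (rdot z z / 2)) => t.
apply: ler_addgt0 => e2 e20.
have [e e0 eE] : exists2 e : R, 0 < e & e2 = 2 * e by exists (e2 / 2); lra.
have d0 : 0 < e / (1 + `|t| * rnorm z).
  by rewrite divr_gt0 // ltr_wpDr // mulr_ge0 ?rnorm_ge0.
have [N1 hN1] := hg _ d0.
have [N2 hN2] := smallN e e0.
pose i := maxn N1 N2.
have h1 := hN1 i (leq_maxl _ _).
have h2 := le_lt_trans (invN _ _ (leq_maxr N1 N2)) hN2.
have h3 := hu i.
have := mJ (u i + t%:C *: z).
rewrite /J psiD psiZ rdotDl !rdotDr !rdotZr !rdotZl (rdotC z (u i)) => h4.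
move: h3; rewrite /J => h3.
have h5 : `|t * rdot z (u i - g)| < e.
  rewrite normrM (le_lt_trans (ler_wpM2l _ (ler_abs_rdot _ _))) //.
  rewrite mulrA.
  move: h1; rewrite ltr_pdivlMr; last by rewrite ltr_wpDr // mulr_ge0 ?rnorm_ge0.
  have := rnorm_ge0 (u i - g) => *; lra.
move: h5; rewrite rdotDr rdotNr ltr_norml (rdotC z (u i)) => /andP[h5 h6].
move: h2 h3; rewrite -/i eE; move: (i.+1%:R^-1 : R) => *; lra.
Qed.

Lemma is_adjoint_unique H (f g g' : H -> H) :
  is_adjoint f g -> is_adjoint f g' -> g = g'.
Proof.
move=> h h'; apply/funext => y; apply: rdot_eq => z.
by rewrite rdotC (rdotC _ z) /rdot -h -h'.
Qed.

Lemma adjE H (f g : H -> H) : is_adjoint f g -> adj f = g.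
Proof.
rewrite /adj => fg; case: xgetP => [h _ /= fh|/(_ g)//].
exact: is_adjoint_unique fh fg.
Qed.

Lemma is_adjointP H (f g : H -> H) : linear_op f ->
  (forall x y, rdot (f x) y = rdot x (g y)) -> is_adjoint f g.
Proof.
move=> lf h x y.
have := h x y; have := h ('i *: x) y; rewrite linear_opZ // !rdotiZl /rdot.
by case: '[f x, y] => a b; case: '[x, g y] => c d /= /oppr_inj -> ->.
Qed.

(** [adj] is a choice with default 0; Riesz, applied to x |-> Re<f x, y> for each y, shows that
    there is an adjoint to choose. *)
Lemma adjP H (f : H -> H) : bounded_ops H f -> is_adjoint f (adj f).
Proof.
move=> bf; have lf := bounded_linear bf.
have [M M0 hM] := bounded_norm_bound bf.
have /choice[g hg] (y : H) : exists g : H, forall x, rdot (f x) y = rdot x g.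
  apply: (@riesz H (fun x => rdot (f x) y) (M * rnorm y)) => [x z|r x|x].
  - by rewrite linear_opD // rdotDl.
  - by rewrite linear_opZ // rdotZl.
  - rewrite (le_trans (ler_rdot _ _)) // mulrAC.
    by rewrite ler_wpM2r ?rnorm_ge0.
have fg : is_adjoint f g by apply: is_adjointP.
by rewrite (adjE fg).
Qed.

Lemma rdot_adj H (f : H -> H) x y : bounded_ops H f ->
  rdot (f x) y = rdot x (adj f y).
Proof. by move=> /adjP h; rewrite /rdot h. Qed.

Lemma rdot_adjl H (f : H -> H) x y : bounded_ops H f ->
  rdot (adj f x) y = rdot x (f y).
Proof. by move=> bf; rewrite rdotC -rdot_adj // rdotC. Qed.

Lemma is_adjointC H (f g : H -> H) : is_adjoint f g -> is_adjoint g f.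
Proof. by move=> h x y; rewrite hdotC -h -hdotC. Qed.

Lemma adjoint_linear H (f g : H -> H) : is_adjoint f g -> linear_op g.
Proof.
move=> h c x y; apply: rdot_eq => z; rewrite /rdot hdot_linear.
by rewrite !(is_adjointC h) hdot_linear.
Qed.

Lemma adjoint_norm_bound H (f g : H -> H) (M : R) : 0 <= M -> norm_bound f M ->
  is_adjoint f g -> norm_bound g M.
Proof.
move=> M0 hM fg y; have [->|gy0] := eqVneq (g y) 0.
  by rewrite rnorm0 mulr_ge0 ?rnorm_ge0.
rewrite -rnorm_gt0 in gy0.
have : rdot (g y) (g y) <= M * rnorm (g y) * rnorm y.
  rewrite /rdot -fg (le_trans (ler_rdot _ _)) // ler_wpM2r ?rnorm_ge0 //.
by rewrite rdotxx expr2 mulrAC ler_pM2r.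
Qed.

Lemma bounded_adj H (f : H -> H) : bounded_ops H f -> bounded_ops H (adj f).
Proof.
move=> bf; have [M M0 hM] := bounded_norm_bound bf.
apply: (@norm_bound_bounded _ _ _ M); first exact: adjoint_linear (adjP bf).
exact: adjoint_norm_bound (ltW M0) hM (adjP bf).
Qed.

Lemma adjK H (f : H -> H) : bounded_ops H f -> adj (adj f) = f.
Proof. by move=> /adjP/is_adjointC/adjE. Qed.

Lemma adjM H (f g : H -> H) : bounded_ops H f -> bounded_ops H g ->
  adj (f \o g) = adj g \o adj f.
Proof. by move=> bf bg; apply: adjE => x y /=; rewrite !adjP. Qed.

Lemma adj_id H : adj (@id H) = id.
Proof. exact: adjE. Qed.

Lemma bounded_lin H c (f g : H -> H) : bounded_ops H f -> bounded_ops H g ->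
  bounded_ops H (c *: f + g).
Proof.
move=> bf bg; have [M M0 hM] := bounded_norm_bound bf.
have [N N0 hN] := bounded_norm_bound bg.
apply: (@norm_bound_bounded _ _ _ (complex.Re `|c| * M + N)) => [d x y|x].
  rewrite -[LHS]/(c *: f (d *: x + y) + g (d *: x + y)).
  rewrite -[RHS]/(d *: (c *: f x + g x) + (c *: f y + g y)).
  rewrite (bounded_linear bf) (bounded_linear bg) !scalerDr !scalerA (mulrC c).
  by rewrite -!addrA; congr (_ + _); rewrite addrCA.
rewrite (le_trans (ler_rnormD _ _)) // rnormZ mulrDl -mulrA lerD //.
by rewrite ler_wpM2l // normc_def sqrtr_ge0.
Qed.

Lemma bounded_id H : bounded_ops H id.
Proof.
apply: (@norm_bound_bounded _ _ _ 1) => [//|x]; by rewrite mul1r.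
Qed.

Lemma bounded_0 H : bounded_ops H 0.
Proof.
apply: (@norm_bound_bounded _ _ _ 0) => [c x y|x].
  by rewrite /GRing.zero /= scaler0 addr0.
by rewrite mul0r rnorm0.
Qed.

Lemma norm_bound_comp H (f g : H -> H) (M N : R) : 0 <= M ->
  norm_bound f M -> norm_bound g N -> norm_bound (f \o g) (M * N).
Proof.
move=> M0 hf hg x; rewrite (le_trans (hf _)) // -mulrA ler_wpM2l //.
Qed.

Lemma norm_boundD H (f g : H -> H) (M N : R) :
  norm_bound f M -> norm_bound g N -> norm_bound (f + g) (M + N).
Proof.
by move=> hf hg x; rewrite (le_trans (ler_rnormD _ _)) // mulrDl lerD.
Qed.

Lemma bounded_comp H (f g : H -> H) : bounded_ops H f -> bounded_ops H g ->
  bounded_ops H (f \o g).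
Proof.
move=> bf bg; have [M M0 hM] := bounded_norm_bound bf.
have [N N0 hN] := bounded_norm_bound bg.
apply: (@norm_bound_bounded _ _ _ (M * N)) => [d x y|].
  by rewrite /= (bounded_linear bg) (bounded_linear bf).
exact: norm_bound_comp (ltW M0) hM hN.
Qed.

Lemma opnorm_has_sup H (f : H -> H) : bounded_ops H f ->
  has_sup [set r | exists x : H, `|x| <= 1 /\ r = complex.Re `|f x|].
Proof.
move=> bf; split.
  by exists (rnorm (f 0)), 0; split; rewrite // normr0 ler01.
have [M M0 hM] := bounded_norm_bound bf.
exists M => _ [x [x1 ->]]; rewrite (le_trans (hM x)) // (ler_piMr (ltW M0)) //.
by move: x1; rewrite normE -(rmorph1 (real_complex R)) lecR.
Qed.

Lemma opnormP H (f : H -> H) : bounded_ops H f -> norm_bound f (opnorm f).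
Proof.
move=> bf x; have lf := bounded_linear bf.
have [->|x0] := eqVneq x 0; first by rewrite linear_op0 // !rnorm0 mulr0.
rewrite -rnorm_gt0 in x0.
rewrite -ler_pdivrMr // mulrC.
rewrite -[X in X * _]gtr0_norm ?invr_gt0 // -rnormZr -linear_opZ //.
rewrite /opnorm; apply: ub_le_sup; first by case: (opnorm_has_sup bf).
exists (((rnorm x)^-1)%:C *: x); split=> //.
rewrite normE rnormZr gtr0_norm ?invr_gt0 // mulVf ?gt_eqF //.
Qed.

Lemma opnorm_le H (f : H -> H) M : 0 <= M -> norm_bound f M -> opnorm f <= M.
Proof.
move=> M0 hM; apply: ge_sup.
  by exists (rnorm (f 0)), 0; split; rewrite // normr0 ler01.
move=> _ [x [x1 ->]]; rewrite (le_trans (hM x)) // ler_piMr //.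
by move: x1; rewrite normE -(rmorph1 (real_complex R)) lecR.
Qed.

Lemma bounded_ops_cstar H : cstar_algebra (bounded_ops H).
Proof.
split; last exact: bounded_adj.
by split; [|exact: bounded_0|exact: bounded_lin|exact: bounded_comp|].
Qed.

End Adjoint.

(** * Neumann series in operator algebras *)

Section OperatorAlgebras.
Context {R : realType}.
Implicit Types H K : hilbertType R.

Lemma geometric_lt (C r e : R) : 0 <= r < 1 -> 0 < e -> exists k, C * r ^+ k < e.
Proof.
move=> /andP[r0 r1] e0.
have /cvgrPdist_lt/(_ (e / (`|C| + 1))) : (fun k => r ^+ k) @ \oo --> (0 : R).
  by apply: cvg_expr; rewrite ger0_norm.
have C0 : 0 < `|C| + 1 by rewrite ltr_wpDl.
rewrite divr_gt0 // => /(_ isT)[k _ /(_ k (leqnn k))].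
rewrite sub0r normrN ger0_norm ?exprn_ge0 // ltr_pdivlMr // => h.
exists k; rewrite (le_lt_trans _ h) // mulrC ler_wpM2l ?exprn_ge0 //.
by rewrite (le_trans (ler_norm _)) // lerDl.
Qed.

Lemma geometric_le0 (C r x : R) : 0 <= r < 1 -> (forall k, x <= C * r ^+ k) ->
  x <= 0.
Proof.
move=> hr h; rewrite leNgt; apply/negP => x0.
by have [k] := geometric_lt C hr x0; rewrite ltNge h.
Qed.

Lemma norm_bound_geometric_eq0 H (f : H -> H) (C r : R) : 0 <= r < 1 ->
  (forall k, norm_bound f (C * r ^+ k)) -> f = 0.
Proof.
move=> hr h; apply/funext => x; apply: rnorm0_eq0; apply/eqP.
rewrite eq_le rnorm_ge0 andbT.
by apply: (@geometric_le0 (C * rnorm x) r) => // k; rewrite mulrAC; apply: h.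
Qed.

Lemma norm_boundB H (f g h : H -> H) (M N : R) :
  norm_bound (f - g) M -> norm_bound (g - h) N -> norm_bound (f - h) (M + N).
Proof.
by move=> hf /(norm_boundD hf) hfg x; have := hfg x; rewrite addrA subrK.
Qed.

Lemma norm_boundC H (f g : H -> H) (M : R) :
  norm_bound (f - g) M -> norm_bound (g - f) M.
Proof. by move=> h x; have := h x; rewrite -rnormN -[- _]/((- (f - g)) x) opprB. Qed.

Lemma norm_boundZ H (f : H -> H) (M r : R) : 0 <= r ->
  norm_bound f M -> norm_bound (r%:C *: f) (r * M).
Proof.
move=> r0 hf x; rewrite -[(_ *: _) x]/(r%:C *: f x) rnormZr ger0_norm //.
by rewrite -mulrA ler_wpM2l.
Qed.

Lemma norm_bound_le H K (f : H -> K) (M N : R) : norm_bound f M -> M <= N ->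
  norm_bound f N.
Proof. by move=> hf MN x; rewrite (le_trans (hf x)) // ler_wpM2r ?rnorm_ge0. Qed.

Section Closure.
Context {H : hilbertType R} (A : set (H -> H)).
Context (hA : operator_algebra A).

Lemma opalg_bounded a : A a -> bounded_ops H a.
Proof. by case: hA => h _ _ _ _; apply: h. Qed.

Lemma opalg_lin (c : R[i]) a b : A a -> A b -> A (c *: a + b).
Proof. by case: hA => _ _ h _ _; apply: h. Qed.

Lemma opalg0 : A 0.
Proof. by case: hA. Qed.

Lemma opalg_comp a b : A a -> A b -> A (a \o b).
Proof. by case: hA => _ _ _ h _; apply: h. Qed.

Lemma opalgZ (c : R[i]) a : A a -> A (c *: a).
Proof. by move=> Aa; rewrite -[_ *: _]addr0; apply: opalg_lin => //; exact: opalg0. Qed.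

Lemma opalgD a b : A a -> A b -> A (a + b).
Proof. by move=> Aa Ab; rewrite -[a]scale1r; exact: opalg_lin. Qed.

Lemma opalgB a b : A a -> A b -> A (a - b).
Proof. by move=> Aa Ab; rewrite -scaleN1r; apply: opalgD => //; exact: opalgZ. Qed.

Lemma opalg_sum I (r : seq I) (F : I -> H -> H) : (forall i, A (F i)) ->
  A (\sum_(i <- r) F i).
Proof. by move=> hF; apply: big_ind => // [|a b]; [exact: opalg0|exact: opalgD]. Qed.

Lemma opalg_closed a : bounded_ops H a ->
  (forall e : R, 0 < e -> exists b, A b /\ norm_bound (a - b) e) -> A a.
Proof.
move=> ba h; case: hA => _ _ _ _; apply=> // e e0.
(* The closure clause asks for a strict inequality, hence half of e. *)
have [b [Ab hb]] := h (e / 2) ltac:(by rewrite divr_gt0).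
exists b; split=> //; rewrite (le_lt_trans (opnorm_le _ hb)) ?divr_ge0 ?ltW //.
by rewrite gtr_pMr // invf_lt1 // ltr1n.
Qed.

Lemma opalg_limit (p : nat -> H -> H) (C r : R) : 0 <= C -> 0 <= r < 1 ->
  (forall k, A (p k)) -> (forall k, norm_bound (p k.+1 - p k) (C * r ^+ k)) ->
  exists2 s, A s & forall k, norm_bound (s - p k) (C / (1 - r) * r ^+ k).
Proof.
move=> C0 hr Ap hp; have [r0 r1] := andP hr.
have r1' : 1 - r != 0 by rewrite subr_eq0 gt_eqF.
set D := C / (1 - r).
have D0 : 0 <= D by rewrite divr_ge0 // subr_ge0 ltW.
(* Stated with the exact partial sum of the geometric series, so that the induction on d closes;
   [hd'] then drops the subtracted term. *)
have hd k d : norm_bound (p (k + d)%N - p k) (D * (r ^+ k - r ^+ (k + d))).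
  elim: d => [|d IHd].
    by move=> x; rewrite addn0 !subrr mulr0 mul0r rnorm0.
  rewrite addnS; apply: norm_bound_le (norm_boundB (hp (k + d)%N) IHd) _.
  rewrite exprS -/D le_eqVlt; apply/orP; left; apply/eqP.
  by rewrite /D; field.
have hd' k d : norm_bound (p (k + d)%N - p k) (D * r ^+ k).
  apply: norm_bound_le (hd k d) _; rewrite ler_wpM2l // gerBl.
  by rewrite exprn_ge0.
have cv (x : H) : exists l, forall k, rnorm (l - p k x) <= D * r ^+ k * rnorm x.
  have [e e0|l hl] := @rnorm_cauchy_cvg _ H (fun k => p k x).
    have [N hN] := geometric_lt (2 * D * rnorm x) hr e0.
    exists N => i j Ni Nj.
    have := ler_rnormD (p i x - p N x) (- (p j x - p N x)).
    rewrite opprB addrA subrK (rnormB (p N x)) => h; apply: (le_lt_trans h).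
    have := hd' N (i - N)%N x; have := hd' N (j - N)%N x; rewrite !subnKC //.
    rewrite -![(_ - _) x]/(_ x - _ x) => h1 h2.
    apply: le_lt_trans hN; lra.
  exists l => k; apply: ler_addgt0 => e /hl[N hN].
  have := hN (k + N)%N (leq_addl _ _); rewrite rnormB => h1.
  have := hd' k N x; rewrite -[(_ - _) x]/(_ x - _ x) => h2.
  have := ler_rnormD (l - p (k + N)%N x) (p (k + N)%N x - p k x).
  rewrite addrA subrK => h3; lra.
have [s hs] := choice cv.
have ls : linear_op s.
  move=> c x y; apply/subr0_eq/rnorm0_eq0/eqP.
  rewrite eq_le rnorm_ge0 andbT.
  pose K := D * rnorm (c *: x + y) + complex.Re `|c| * (D * rnorm x) +
    D * rnorm y.
  apply: (@geometric_le0 K r) => // k.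
  rewrite -[s _](subrK (p k (c *: x + y))).
  rewrite (bounded_linear (opalg_bounded (Ap k))).
  rewrite -addrA.
  have -> : c *: p k x + p k y - (c *: s x + s y) =
     - (c *: (s x - p k x)) - (s y - p k y).
     by rewrite scalerBr !opprB opprD addrACA.
  rewrite (le_trans (ler_rnormD _ _)) //.
have c0 : 0 <= complex.Re `|c| by rewrite normc_def sqrtr_ge0.
  have := ler_rnormD (- (c *: (s x - p k x))) (- (s y - p k y)).
  rewrite !rnormN rnormZ.
  have := hs (c *: x + y) k.
  rewrite (bounded_linear (opalg_bounded (Ap k))).
  have := ler_wpM2l c0 (hs x k); have := hs y k.
  rewrite /K => *; lra.
have bs : bounded_ops H s.
  have [M M0 hM] := bounded_norm_bound (opalg_bounded (Ap 0%N)).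
  apply: (@norm_bound_bounded _ _ _ (D + M)) => // x.
  rewrite -[s x](subrK (p 0%N x)) (le_trans (ler_rnormD _ _)) // mulrDl lerD //.
  by have := hs x 0%N; rewrite expr0 mulr1.
exists s => [|k x]; last exact: hs.
apply: opalg_closed => // e e0.
have [k hk] := geometric_lt D hr e0.
exists (p k); split=> //; apply: norm_bound_le (ltW hk) => x; exact: hs.
Qed.

(** The partial sums p_k of the series of powers of h satisfy p_(k+1) = 1 + h p_k and commute with
    h. In the limit s = 1 + h s and s h = h s, which give the inverse on both sides. *)
Lemma neumann h (q : R) : 0 <= q < 1 -> A id -> A h -> norm_bound h q ->
  exists2 s, A s & s \o (id - h) = id /\ (id - h) \o s = id.
Proof.
move=> hq Aid Ah hh; have [q0 q1] := andP hq.
pose p (k : nat) : H -> H := iter k (fun f => id + (h \o f)) 0.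
have Ap k : A (p k).
  elim: k => [|k IHk]; first exact: opalg0.
  by apply: opalgD => //; exact: opalg_comp.
have lh := bounded_linear (opalg_bounded Ah).
have pS k : p k.+2 - p k.+1 = h \o (p k.+1 - p k).
  apply/funext => x; rewrite [RHS](linear_opB lh) /=.
  rewrite -[LHS]/(x + h (p k.+1 x) - (x + h (p k x))).
  by rewrite opprD addrACA subrr add0r.
have hp k : norm_bound (p k.+1 - p k) (1 * q ^+ k).
  elim: k => [|k IHk].
    move=> x; rewrite -[(_ - _) x]/(x + h 0 - 0) subr0 linear_op0 // addr0.
    by rewrite expr0 !mul1r.
  rewrite pS exprS mulrCA; exact: norm_bound_comp.
have [s As hs] := opalg_limit ler01 hq Ap hp.
have ls := bounded_linear (opalg_bounded As).
exists s => //.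
have comm k : p k \o h = h \o p k.
  elim: k => [|k IHk]; first by apply/funext => x /=; rewrite linear_op0.
  apply/funext => x; rewrite -[RHS]/(h (x + h (p k x))).
  rewrite (linear_opD lh) -[LHS]/(h x + h (p k (h x))).
  by rewrite -[p k (h x)]/((p k \o h) x) IHk.
set E := 1 / (1 - q) in hs.
have E0 : 0 <= E by rewrite divr_ge0 // subr_ge0 ltW.
have h1 : norm_bound h 1 by apply: norm_bound_le hh _; exact: ltW.
have e1 : s = id + (h \o s).
  apply/subr0_eq; apply: (@norm_bound_geometric_eq0 _ _ (2 * E) q) => // k.
  have hs1 : norm_bound (s - p k.+1) (E * q ^+ k).
    apply: norm_bound_le (hs k.+1) _; rewrite ler_wpM2l // exprS.
    by rewrite ler_piMl ?exprn_ge0 // ltW.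
  have hs2 : norm_bound (p k.+1 - (id + (h \o s))) (1 * (E * q ^+ k)).
    have -> : p k.+1 - (id + (h \o s)) = h \o (p k - s).
      apply/funext => x; rewrite -[LHS]/(x + h (p k x) - (x + h (s x))).
      by rewrite opprD addrACA subrr add0r -(linear_opB lh).
    exact: norm_bound_comp ler01 h1 (norm_boundC (hs k)).
  apply: norm_bound_le (norm_boundB hs1 hs2) _.
  by rewrite mul1r -mulr2n -[_ *+ 2]mulr_natl mulrA.
have e2 : s \o h = h \o s.
  apply/subr0_eq; apply: (@norm_bound_geometric_eq0 _ _ (2 * E) q) => // k.
  have hs1 : norm_bound ((s \o h) - (p k \o h)) (E * q ^+ k * 1).
    apply: (@norm_bound_comp _ _ (s - p k)) => //.
    by rewrite mulr_ge0 ?exprn_ge0.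
  have hs2 : norm_bound ((p k \o h) - (h \o s)) (1 * (E * q ^+ k)).
    have -> : (p k \o h) - (h \o s) = h \o (p k - s).
      by rewrite comm; apply/funext => x; rewrite [RHS](linear_opB lh).
    exact: norm_bound_comp ler01 h1 (norm_boundC (hs k)).
  apply: norm_bound_le (norm_boundB hs1 hs2) _.
  by rewrite mul1r mulr1 -mulr2n -[_ *+ 2]mulr_natl mulrA.
split; apply/funext => x /=.
  rewrite -[(_ - _) x]/(x - h x) (linear_opB ls) -[s (h x)]/((s \o h) x) e2.
  by rewrite [in X in X - _]e1 /= -[(_ + _) x]/(x + h (s x)) addrK.
rewrite -[(_ - _) _]/(s x - h (s x)).
by rewrite [in X in X - _]e1 /= -[(_ + _) x]/(x + h (s x)) addrK.
Qed.

End Closure.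
End OperatorAlgebras.

(** * *-homomorphisms *)

Section StarHomomorphisms.
Context {R : realType}.
Implicit Types H K : hilbertType R.

Lemma cstar_opalg H (A : set (H -> H)) : cstar_algebra A -> operator_algebra A.
Proof. by case. Qed.

Lemma cstar_adj H (A : set (H -> H)) a : cstar_algebra A -> A a -> A (adj a).
Proof. by case=> _; apply. Qed.

Lemma rnorm_sqrD H (x y : H) :
  rnorm (x + y) ^+ 2 = rnorm x ^+ 2 + 2 * rdot x y + rnorm y ^+ 2.
Proof. rewrite -!rdotxx rdotDl !rdotDr (rdotC y x); ring. Qed.

Lemma rdot_adj_comp H (f : H -> H) x : bounded_ops H f ->
  rdot (adj f (f x)) x = rnorm (f x) ^+ 2.
Proof. by move=> bf; rewrite rdot_adjl // rdotxx. Qed.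

Lemma norm_bound_adj H (f : H -> H) (M : R) : 0 <= M -> bounded_ops H f ->
  norm_bound f M -> norm_bound (adj f) M.
Proof. by move=> M0 bf hf; apply: (adjoint_norm_bound M0 hf); exact: adjP. Qed.

(** For P = m^2 - f^* f, which satisfies 0 <= P <= m^2, this is P^2 <= m^2 P tested at x. *)
Lemma rnorm_defect H (f : H -> H) (m : R) x : 0 <= m -> bounded_ops H f ->
  norm_bound f m ->
  rnorm ((m ^+ 2)%:C *: x - adj f (f x)) ^+ 2 <=
  m ^+ 2 * (m ^+ 2 * rnorm x ^+ 2 - rnorm (f x) ^+ 2).
Proof.
move=> m0 bf hf.
rewrite rnorm_sqrD rdotNr rdotZl rnormZr rnormN ger0_norm ?sqr_ge0 //.
rewrite (rdotC x) rdot_adj_comp //.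
have : rnorm (adj f (f x)) ^+ 2 <= (m * rnorm (f x)) ^+ 2.
  rewrite ler_pXn2r ?nnegrE ?mulr_ge0 ?rnorm_ge0 //.
  exact: norm_bound_adj.
rewrite exprMn => h; rewrite exprMn; lra.
Qed.

Lemma one_plus_inverse H (A : set (H -> H)) a (c : R) : cstar_algebra A ->
  A id -> A a -> 0 <= c ->
  exists2 y, A y &
    forall x, x = y x + c%:C *: adj a (a (y x)).
Proof.
move=> hA Aid Aa c0; have oA := cstar_opalg hA.
have ba := opalg_bounded oA Aa.
have [m m0 hm] := bounded_norm_bound ba.
pose M := c * m ^+ 2.
have M0 : 0 <= M by rewrite mulr_ge0 // sqr_ge0.
have M1 : 0 < 1 + M by rewrite ltr_wpDr.
(* Chosen so that 1 + c a^* a = (1 + M)(1 - t): shifting by M turns a possibly large positive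
   perturbation of 1 into one of norm at most M / (1 + M) < 1. *)
pose t := ((1 + M)^-1)%:C *: (c%:C *: ((m ^+ 2)%:C *: id - (adj a \o a))).
have At : A t.
  apply: opalgZ => //; apply: opalgZ => //; apply: opalgB => //.
    exact: opalgZ.
  by apply: opalg_comp => //; exact: cstar_adj.
have ht : norm_bound t (M / (1 + M)).
  have -> : M / (1 + M) = (1 + M)^-1 * (c * m ^+ 2) by rewrite mulrC.
  apply: norm_boundZ; first by rewrite invr_ge0 ltW.
  apply: norm_boundZ => // x; apply: ler_rnorm_sqr.
    by rewrite mulr_ge0 ?sqr_ge0 ?rnorm_ge0.
  rewrite rdotxx; apply: le_trans (rnorm_defect x (ltW m0) ba hm) _.
  have := mulr_ge0 (sqr_ge0 m) (sqr_ge0 (rnorm (a x))).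
  rewrite exprMn => *; lra.
have q1 : 0 <= M / (1 + M) < 1.
  by rewrite divr_ge0 ?(ltW M1) //= ltr_pdivrMr // mul1r ltrDr.
have [s As [_ es]] := neumann oA q1 Aid At ht.
exists (((1 + M)^-1)%:C *: s); first exact: opalgZ.
have la := bounded_linear ba.
have laa := bounded_linear (bounded_adj ba).
move=> x; have := congr1 (@^~ x) es.
rewrite -[(_ \o _) x]/(s x -
  ((1 + M)^-1)%:C *: (c%:C *: ((m ^+ 2)%:C *: s x - adj a (a (s x))))).
rewrite -[(_ *: s) x]/(((1 + M)^-1)%:C *: s x) => {1}<-.
rewrite (linear_opZ la) (linear_opZ laa) !scalerBr !scalerA opprB addrA.
rewrite -!rmorphM /= addrAC (mulrC c); congr (_ + _).
rewrite -{1}[s x]scale1r -scalerBl -(rmorph1 (real_complex R)) -rmorphB /=.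
by congr (_%:C *: _); rewrite /M; field; rewrite gt_eqF.
Qed.

(** If b = pi(a) had norm N > m, then 1 - a^* a / N^2 would be invertible in A by Neumann, and
    applying pi would make N^2 - b^* b bounded below. By [rnorm_defect], N^2 |x|^2 - |b x|^2 would
    then dominate a positive multiple of |x|^2, so b would have norm less than N. *)
Lemma star_hom_contractive H K (A : set (H -> H)) (pi : (H -> H) -> (K -> K))
    a (m : R) : cstar_algebra A -> A id -> unital_rep A pi -> A a -> 0 <= m ->
  norm_bound a m -> norm_bound (pi a) m.
Proof.
move=> hA Aid [[[piB piL piM] piS] pi1] Aa m0 ha; have oA := cstar_opalg hA.
set b := pi a; have bb : bounded_ops K b by exact: piB.
suff : opnorm b <= m by move=> bm; exact: norm_bound_le (opnormP bb) bm.
rewrite leNgt; apply/negP; set N := opnorm b => mN.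
have N0 : 0 < N by exact: le_lt_trans mN.
have [ba bpa] := (opalg_bounded oA Aa, opalg_bounded oA (cstar_adj hA Aa)).
have Aaa : A (adj a \o a) by apply: opalg_comp => //; exact: cstar_adj.
pose h := ((N ^+ 2)^-1)%:C *: (adj a \o a).
have Ah : A h by exact: opalgZ.
have hh : norm_bound h ((N ^+ 2)^-1 * (m * m)).
  apply: norm_boundZ; first by rewrite invr_ge0 sqr_ge0.
  by apply: norm_bound_comp => //; exact: norm_bound_adj.
have q1 : 0 <= (N ^+ 2)^-1 * (m * m) < 1.
  rewrite mulr_ge0 ?invr_ge0 ?sqr_ge0 ?mulr_ge0 //= mulrC ltr_pdivrMr ?exprn_gt0 //.
  by rewrite mul1r -expr2 ltr_pXn2r ?nnegrE // ltW.
have [s As [es _]] := neumann oA q1 Aid Ah hh.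
have [L L0 hL] := bounded_norm_bound (piB _ As).
have key x : rnorm x <= L / N ^+ 2 * rnorm ((N ^+ 2)%:C *: x - adj b (b x)).
  have e1 : pi (id - h) = ((N ^+ 2)^-1)%:C *: ((N ^+ 2)%:C *: id - (adj b \o b)).
    rewrite addrC -(scaleN1r h) (piL _ _ _ Ah Aid) /h.
    have -> : pi (((N ^+ 2)^-1)%:C *: (adj a \o a)) =
        ((N ^+ 2)^-1)%:C *: (adj b \o b).
      have := piL ((N ^+ 2)^-1)%:C _ 0 Aaa (opalg0 oA).
      have -> : pi 0 = 0.
        have := piL (-1) 0 0 (opalg0 oA) (opalg0 oA).
        by rewrite !scaleN1r oppr0 addr0 addNr.
      by rewrite !addr0 piM // ?piS //; exact: cstar_adj.
    rewrite pi1 scaleN1r [RHS]scalerBr scalerA -rmorphM /= mulVf ?gt_eqF ?exprn_gt0 //.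
    by rewrite rmorph1 scale1r addrC.
  have := congr1 pi es; rewrite pi1 piM //; last exact: opalgB.
  move=> /(congr1 (@^~ x)) /= ex; rewrite -{1}ex e1.
  rewrite (le_trans (hL _)) // -mulrA ler_wpM2l ?(ltW L0) //.
  by rewrite rnormZr ger0_norm ?invr_ge0 ?sqr_ge0.
have N20 : 0 < N ^+ 2 by rewrite exprn_gt0.
(* L' > 1 keeps N^2 - N^2 / L'^2, whose square root is the improved bound on b, nonnegative. *)
pose L' := L + 1.
have L'0 : 0 < L' by rewrite addr_gt0.
have N'0 : 0 <= N ^+ 2 - N ^+ 2 / L' ^+ 2.
  rewrite subr_ge0 ler_pdivrMr ?exprn_gt0 // ler_pMr //.
  by rewrite expr_ge1 ?ltW // ltrDr.
have key2 x : rnorm (b x) ^+ 2 <= (N ^+ 2 - N ^+ 2 / L' ^+ 2) * rnorm x ^+ 2.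
  have k1 : rnorm x ^+ 2 <= (L' / N ^+ 2) ^+ 2 *
      (N ^+ 2 * (N ^+ 2 * rnorm x ^+ 2 - rnorm (b x) ^+ 2)).
    have hd := rnorm_defect x (ltW N0) bb (opnormP bb).
    apply: le_trans (ler_wpM2l (sqr_ge0 _) hd).
    rewrite -exprMn ler_pXn2r ?nnegrE ?mulr_ge0 ?rnorm_ge0 ?invr_ge0 //;
      rewrite ?(ltW L'0) ?(ltW N20) //.
    rewrite (le_trans (key x)) // ler_wpM2r ?rnorm_ge0 // ler_wpM2r //.
      by rewrite invr_ge0 ltW.
    by rewrite lerDl.
  have k2 : N ^+ 2 / L' ^+ 2 * rnorm x ^+ 2 <=
      N ^+ 2 * rnorm x ^+ 2 - rnorm (b x) ^+ 2.
    rewrite mulrAC ler_pdivrMr ?exprn_gt0 // mulrC -ler_pdivlMr //.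
    apply: (le_trans k1); rewrite le_eqVlt; apply/orP; left; apply/eqP.
    by field; rewrite gt_eqF.
  lra.
pose N' := Num.sqrt (N ^+ 2 - N ^+ 2 / L' ^+ 2).
have : norm_bound b N'.
  move=> x; apply: ler_rnorm_sqr; first by rewrite mulr_ge0 ?sqrtr_ge0 ?rnorm_ge0.
  by rewrite rdotxx exprMn sqr_sqrtr.
move=> /(opnorm_le (sqrtr_ge0 _)); rewrite leNgt => /negP; apply.
rewrite -(@ltr_pXn2r _ 2) ?nnegrE ?sqrtr_ge0 ?(ltW N0) // sqr_sqrtr //.
by rewrite gtrBl divr_gt0 // exprn_gt0.
Qed.
End StarHomomorphisms.

(** * Representations of C*-algebras have closed range *)

Section ClosedRange.
Context {R : realType}.
Implicit Types H K : hilbertType R.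

(** From |z + w|^2 - |z - w|^2 = 4 Re<z, w>. With z = (1 + a^* a / m^2)^-1 x, w = a^* a z / m^2 and
    u = a z this is the bound t / (1 + t^2) <= 1/2 in operator form. *)
Lemma rnorm_half H (x z w u : H) (m : R) : 0 < m ->
  x = z + w -> rdot z w = (rnorm u / m) ^+ 2 -> rnorm u <= m / 2 * rnorm x.
Proof.
move=> m0 -> e; apply: ler_rnorm_sqr.
  by rewrite mulr_ge0 ?rnorm_ge0 // divr_ge0 // ltW.
have -> : rdot u u = m ^+ 2 * rdot z w.
  by rewrite e rdotxx; field; rewrite gt_eqF.
rewrite exprMn rnorm_sqrD exprMn.
have := sqr_ge0 (rnorm (z - w)); rewrite rnorm_sqrD rnormN rdotNr => h.
have : 0 <= m ^+ 2 * (rnorm z ^+ 2 + 2 * - rdot z w + rnorm w ^+ 2).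
  by rewrite mulr_ge0 // sqr_ge0.
lra.
Qed.

Section AlgHom.
Context {H K : hilbertType R} (A : set (H -> H)) (B : set (K -> K)).
Context (pi : (H -> H) -> (K -> K)).
Context (oA : operator_algebra A) (hpi : alg_hom A B pi).

Lemma alg_hom_fun a : A a -> B (pi a).
Proof. by case: hpi => h _ _; apply: h. Qed.

Lemma alg_hom_lin (c : R[i]) a b : A a -> A b ->
  pi (c *: a + b) = c *: pi a + pi b.
Proof. by case: hpi => _ h _; apply: h. Qed.

Lemma alg_homM a b : A a -> A b -> pi (a \o b) = pi a \o pi b.
Proof. by case: hpi => _ _ h; apply: h. Qed.

Lemma alg_hom0 : pi 0 = 0.
Proof.
have := alg_hom_lin (-1) (opalg0 oA) (opalg0 oA).
by rewrite !scaleN1r oppr0 addr0 addNr.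
Qed.

Lemma alg_homZ (c : R[i]) a : A a -> pi (c *: a) = c *: pi a.
Proof.
by move=> Aa; have := alg_hom_lin c Aa (opalg0 oA); rewrite alg_hom0 !addr0.
Qed.

Lemma alg_homD a b : A a -> A b -> pi (a + b) = pi a + pi b.
Proof. by move=> Aa Ab; have := alg_hom_lin 1 Aa Ab; rewrite !scale1r. Qed.

Lemma alg_homB a b : A a -> A b -> pi (a - b) = pi a - pi b.
Proof.
move=> Aa Ab; rewrite -(scaleN1r b) -(scaleN1r (pi b)) alg_homD //; last exact: opalgZ.
by rewrite alg_homZ.
Qed.

Lemma alg_hom_sum I (r : seq I) (F : I -> H -> H) : (forall i, A (F i)) ->
  pi (\sum_(i <- r) F i) = \sum_(i <- r) pi (F i).
Proof.
move=> hF; elim: r => [|i r IHr]; first by rewrite !big_nil alg_hom0.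
by rewrite !big_cons alg_homD ?IHr //; exact: opalg_sum.
Qed.

End AlgHom.

Section Rep.
Context {H K : hilbertType R} (A : set (H -> H)) (pi : (H -> H) -> (K -> K)).
Context (hA : cstar_algebra A) (Aid : A id) (hpi : unital_rep A pi).

Let oA := cstar_opalg hA.
Let hom := hpi.1.1.
Let repD := alg_homD hom.
Let repM := alg_homM hom.
Let repB := alg_homB oA hom.

Lemma rep_bounded a : A a -> bounded_ops K (pi a).
Proof. by move=> Aa; apply: (alg_hom_fun hom Aa). Qed.

Lemma rep_adj a : A a -> pi (adj a) = adj (pi a).
Proof. by case: hpi => -[_ h] _; apply: h. Qed.

Lemma rep_contractive a (m : R) : A a -> 0 <= m ->
  norm_bound a m -> norm_bound (pi a) m.
Proof. exact: star_hom_contractive. Qed.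

(* The lift is a (1 + a^*a / m^2)^-1: the function t / (1 + t^2) is at most 1/2
   everywhere, and t - t / (1 + t^2) <= 1/2 for 0 <= t <= 1. *)
Lemma rep_approx_lift a (m : R) : A a -> 0 < m -> norm_bound (pi a) m ->
  exists2 b, A b & norm_bound b (m / 2) /\ norm_bound (pi a - pi b) (m / 2).
Proof.
move=> Aa m0 hm; set c := (m ^+ 2)^-1.
have m20 : 0 < m ^+ 2 by rewrite exprn_gt0.
have c0 : 0 <= c by rewrite invr_ge0 ltW.
have [y Ay hy] := one_plus_inverse hA Aid Aa c0.
have ba := opalg_bounded oA Aa.
have bpa := rep_bounded Aa.
have Aay : A (a \o y) by exact: opalg_comp.
exists (a \o y) => //; split.
  move=> x; apply: (rnorm_half m0 (hy x)).
  by rewrite rdotZr rdotC rdot_adj_comp // /c expr_div_n mulrC.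
have hw x : x = pi y x + c%:C *: adj (pi a) (pi a (pi y x)).
  have Aaa : A (adj a \o (a \o y)).
    by apply: opalg_comp => //; exact: cstar_adj.
  have e : y + c%:C *: (adj a \o (a \o y)) = id by apply/funext => z; rewrite [RHS]hy.
  have := congr1 pi e; rewrite hpi.2 repD //; last exact: opalgZ.
  rewrite (alg_homZ oA hom) // repM //; last exact: cstar_adj.
  by rewrite repM // rep_adj // => /(congr1 (@^~ x)) /esym.
move=> x; set z := pi y x.
rewrite repM // -[(_ - _) x]/(pi a x - pi a z) -(linear_opB (bounded_linear bpa)).
set k := c%:C *: adj (pi a) (pi a z).
have -> : x - z = k by rewrite {1}(hw x) addrC addKr.
rewrite (le_trans (hm _)) // -mulrA ler_wpM2l ?(ltW m0) //.
(* The claim is 4 |k|^2 <= |x|^2 for x = z + k. It follows from |k|^2 <= Re<z, k> <= |z|^2 on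
   expanding |z + k|^2. *)
apply: ler_rnorm_sqr; first by rewrite mulr_ge0 ?rnorm_ge0 ?invr_ge0.
rewrite exprMn [in leRHS](hw x) -/z -/k rnorm_sqrD rdotxx.
have d1 : rdot z k = c * rnorm (pi a z) ^+ 2.
  by rewrite rdotZr rdotC rdot_adj_comp.
have d2 : rnorm (pi a z) ^+ 2 <= m ^+ 2 * rnorm z ^+ 2.
  by rewrite -exprMn ler_pXn2r ?nnegrE ?mulr_ge0 ?rnorm_ge0 ?(ltW m0).
have d3 : rnorm k ^+ 2 <= c * rnorm (pi a z) ^+ 2.
  rewrite rnormZr ger0_norm // exprMn.
  have h : rnorm (adj (pi a) (pi a z)) ^+ 2 <= m ^+ 2 * rnorm (pi a z) ^+ 2.
    rewrite -exprMn ler_pXn2r ?nnegrE ?mulr_ge0 ?rnorm_ge0 ?(ltW m0) //.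
    exact: norm_bound_adj (ltW m0) bpa hm _.
  apply: (le_trans (ler_wpM2l (sqr_ge0 c) h)).
  by rewrite expr2 -mulrA (mulrA c (m ^+ 2)) mulVf ?gt_eqF // mul1r.
have d4 : c * rnorm (pi a z) ^+ 2 <= rnorm z ^+ 2.
  by rewrite mulrC ler_pdivrMr // mulrC.
lra.
Qed.

Lemma rep_closed_range b : bounded_ops K b ->
  (forall e : R, 0 < e -> exists2 a, A a & norm_bound (b - pi a) e) ->
  exists2 a, A a & b = pi a.
Proof.
(* If a is within r^k of b, choose pi(c) within r^k / 8 of b. Then pi(c - a) has norm at most 9/8
   r^k and is lifted up to 9/16 r^k, so the new error is at most (1/8 + 9/16) r^k = 11/16 r^k <=
   r^(k+1). *)
move=> bb hb; pose r : R := 3 / 4.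
have r01 : 0 <= r < 1 by rewrite /r; apply/andP; split; lra.
have [r0 r1] := andP r01.
have rk k : 0 < r ^+ k by rewrite exprn_gt0 // /r; lra.
(* [choice] wants a total relation: the invariants of the recursion become premises, and 0 is the
   value where they fail. *)
have step (ka : nat * (H -> H)) : exists a', A ka.2 ->
    norm_bound (b - pi ka.2) (r ^+ ka.1) ->
    [/\ A a', norm_bound (a' - ka.2) (1 * r ^+ ka.1) &
        norm_bound (b - pi a') (r ^+ ka.1.+1)].
  case: ka => k a /=; have [Aa|nAa] := pselect (A a); last by exists 0.
  have [ha|nha] := pselect (norm_bound (b - pi a) (r ^+ k)); last by exists 0.
  have [c Ac hc] := hb (r ^+ k / 8) ltac:(by rewrite divr_gt0).
  have Ad : A (c - a) by exact: opalgB.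
  have hd : norm_bound (pi (c - a)) (r ^+ k * (9 / 8)).
    rewrite repB //; apply: norm_bound_le (norm_boundB (norm_boundC hc) ha) _; lra.
  have m0 : 0 < r ^+ k * (9 / 8) by rewrite mulr_gt0.
  have [e Ae [he hde]] := rep_approx_lift Ad m0 hd.
  exists (a + e) => _ _; split; first exact: opalgD.
    rewrite addrC addKr; apply: norm_bound_le he _.
    have := rk k; lra.
  have -> : b - pi (a + e) = (b - pi c) + (pi (c - a) - pi e).
    by rewrite repD // repB // addrA addrA subrK opprD addrA.
  apply: norm_bound_le (norm_boundD hc hde) _.
  rewrite exprS [in X in _ <= X * _]/r; have := rk k; lra.
have [F hF] := choice step.
have [a0 Aa0 ha0] := hb 1 ltr01.
pose p := fix p k := if k is k'.+1 then F (k', p k') else a0.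
have hp k : A (p k) /\ norm_bound (b - pi (p k)) (r ^+ k).
  elim: k => [|k [IH1 IH2]]; first by rewrite expr0.
  by have [] := hF (k, p k) IH1 IH2.
have hp' k : norm_bound (p k.+1 - p k) (1 * r ^+ k).
  by have [IH1 IH2] := hp k; have [] := hF (k, p k) IH1 IH2.
have [s As hs] := opalg_limit oA ler01 r01 (fun k => (hp k).1) hp'.
exists s => //; apply/subr0_eq.
apply: (@norm_bound_geometric_eq0 _ _ _ (1 + 1 / (1 - r)) r) => // k.
have [Apk hpk] := hp k.
apply: norm_bound_le (norm_boundB hpk (_ : norm_bound _ (1 / (1 - r) * r ^+ k))) _.
  rewrite -repB //; apply: rep_contractive.
  - exact: opalgB.
  - by rewrite mulr_ge0 ?(ltW (rk k)) // divr_ge0 // subr_ge0 ltW.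
  - exact: norm_boundC.
by rewrite mulrDl !mul1r.
Qed.

(** This is how surjectivity is obtained: a C*-algebra containing a generating family contains all
    that the family generates. *)
Lemma rep_image_cstar : cstar_algebra (pi @` A).
Proof.
split; last first.
  move=> _ [a Aa <-]; exists (adj a); first exact: cstar_adj.
  exact: rep_adj.
split.
- by move=> _ [a Aa <-]; exact: rep_bounded.
- by exists 0; [exact: opalg0|exact: (alg_hom0 oA hom)].
- move=> c _ _ [a Aa <-] [b Ab <-]; exists (c *: a + b); first exact: opalg_lin.
  exact: (alg_hom_lin hom).
- move=> _ _ [a Aa <-] [b Ab <-]; exists (a \o b); first exact: opalg_comp.
  by rewrite repM.
- move=> b bb hb; have [e e0|a Aa ->] := @rep_closed_range b bb; last by exists a.
  have [_ [[a Aa <-] hab]] := hb e e0; exists a => //.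
  apply: norm_bound_le (ltW hab); apply: opnormP.
  rewrite -scaleN1r addrC; apply: bounded_lin => //; exact: rep_bounded.
Qed.

End Rep.
End ClosedRange.

(** * Generated algebras, and homomorphisms known on generators *)

Section GeneratedAlgebras.
Context {R : realType}.
Implicit Types H K : hilbertType R.

(** Boundedness of G makes B(H) one of the algebras in the intersection, which is what bounds its
    elements; the other clauses pass to intersections. *)
Lemma smallest_operator_algebra H (G : set (H -> H)) :
  G `<=` bounded_ops H -> operator_algebra (smallest (@operator_algebra R H) G).
Proof.
move=> hG; split.
- by apply: smallest_sub => //; case: (bounded_ops_cstar H).
- by move=> M [hM _]; exact: opalg0.
- by move=> c a b Aa Ab M hM; apply: opalg_lin; [case: hM|exact: Aa|exact: Ab].
- by move=> a b Aa Ab M hM; apply: opalg_comp; [case: hM|exact: Aa|exact: Ab].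
- move=> a ba h M hM; case: (hM) => -[_ _ _ _ cl] _; apply: cl => // e /h.
  by move=> [b [Ab hb]]; exists b; split=> //; exact: Ab.
Qed.

Lemma smallest_cstar_algebra H (G : set (H -> H)) :
  G `<=` bounded_ops H -> cstar_algebra (smallest (@cstar_algebra R H) G).
Proof.
move=> hG; split; last first.
  by move=> a Aa M hM; apply: cstar_adj; [case: hM|exact: Aa].
split.
- by apply: smallest_sub => //; exact: bounded_ops_cstar.
- by move=> M [[hM _] _]; exact: opalg0.
- by move=> c a b Aa Ab M hM; apply: opalg_lin; [case: hM => -[]|exact: Aa|exact: Ab].
- by move=> a b Aa Ab M hM; apply: opalg_comp; [case: hM => -[]|exact: Aa|exact: Ab].
- move=> a ba h M hM; case: (hM) => -[[_ _ _ _ cl] _] _; apply: cl => // e /h.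
  by move=> [b [Ab hb]]; exists b; split=> //; exact: Ab.
Qed.

Section Gen.
Context {I : Type} {J : set I} {H : hilbertType R} {u : I -> H -> H}.
Context (bu : forall j, J j -> bounded_ops H (u j)).

Lemma cstar_gen_cstar : cstar_algebra (cstar_gen J u).
Proof. by apply: smallest_cstar_algebra => _ [j Jj <-]; exact: bu. Qed.

Lemma opalg_gen_opalg : operator_algebra (opalg_gen J u).
Proof. by apply: smallest_operator_algebra => _ [j Jj <-]; exact: bu. Qed.

End Gen.

Lemma cstar_gen_in I (J : set I) H (u : I -> H -> H) j :
  J j -> cstar_gen J u (u j).
Proof. by move=> Jj; apply: sub_gen_smallest; exists j. Qed.

Lemma opalg_gen_in I (J : set I) H (u : I -> H -> H) j :
  J j -> opalg_gen J u (u j).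
Proof. by move=> Jj; apply: sub_gen_smallest; exists j. Qed.

Lemma cstar_gen_sub I (J : set I) H (u : I -> H -> H) (B : set (H -> H)) :
  cstar_algebra B -> (forall j, J j -> B (u j)) -> cstar_gen J u `<=` B.
Proof. by move=> hB h; apply: smallest_sub => // _ [j Jj <-]; apply: (h j Jj). Qed.

Lemma opalg_gen_sub I (J : set I) H (u : I -> H -> H) (B : set (H -> H)) :
  operator_algebra B -> (forall j, J j -> B (u j)) -> opalg_gen J u `<=` B.
Proof. by move=> hB h; apply: smallest_sub => // _ [j Jj <-]; apply: (h j Jj). Qed.

(** The induction principle for a map known on generators: once the preimage of B is a closed
    algebra, it contains a generated algebra as soon as it contains the generators. Contractivity is
    what makes it closed. *)
Lemma preimage_opalg H K (A : set (H -> H)) (B : set (K -> K))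
    (pi : (H -> H) -> (K -> K)) :
  operator_algebra A -> operator_algebra B -> alg_hom A (bounded_ops K) pi ->
  (forall a (m : R), A a -> 0 <= m -> norm_bound a m -> norm_bound (pi a) m) ->
  operator_algebra [set a | A a /\ B (pi a)].
Proof.
move=> oA oB hom ctr; split.
- by move=> a [Aa _]; exact: opalg_bounded Aa.
- by split; [exact: opalg0|rewrite (alg_hom0 oA hom); exact: opalg0].
- move=> c a b [Aa Ba] [Ab Bb]; split; first exact: opalg_lin.
  by rewrite (alg_hom_lin hom) //; exact: opalg_lin.
- move=> a b [Aa Ba] [Ab Bb]; split; first exact: opalg_comp.
  by rewrite (alg_homM hom) //; exact: opalg_comp.
- move=> a ba h.
  have cl (e : R) : 0 < e -> exists b, [/\ A b, B (pi b) & norm_bound (a - b) e].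
    move=> /h[b [[Ab Bb] hb]]; exists b; split=> //.
    apply: norm_bound_le (ltW hb); apply: opnormP.
    rewrite -scaleN1r addrC; apply: bounded_lin => //; exact: opalg_bounded Ab.
  have Aa : A a.
    by apply: (opalg_closed oA) => // e /cl[b [Ab _ hb]]; exists b.
  split=> //; apply: (opalg_closed oB); first exact: (alg_hom_fun hom Aa).
  move=> e e0; have [b [Ab Bb hb]] := cl e e0; exists (pi b); split=> //.
  rewrite -(alg_homB oA hom) //; apply: ctr => //; last exact: ltW.
  exact: opalgB.
Qed.

Lemma rep_cstar_gen_sub I (J : set I) H K (u : I -> H -> H)
    (pi : (H -> H) -> (K -> K)) (B : set (K -> K)) :
  (forall j, J j -> bounded_ops H (u j)) -> cstar_gen J u id ->
  unital_rep (cstar_gen J u) pi -> cstar_algebra B ->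
  (forall j, J j -> B (pi (u j))) ->
  forall a, cstar_gen J u a -> B (pi a).
Proof.
move=> bu Aid hpi hB h a; have hA := cstar_gen_cstar bu.
suff sub : cstar_gen J u `<=` [set a | cstar_gen J u a /\ B (pi a)].
  by move=> /sub[].
apply: cstar_gen_sub; last by move=> j Jj; split; [exact: cstar_gen_in|exact: h].
split.
  apply: (preimage_opalg (cstar_opalg hA) (cstar_opalg hB) hpi.1.1) => b m.
  exact: (rep_contractive hA Aid hpi).
move=> b [Ab Bb]; split; first exact: (cstar_adj hA Ab).
by rewrite (rep_adj hpi) //; exact: (cstar_adj hB Bb).
Qed.

Lemma unital_rep_comp H1 H2 H3 (A : set (H1 -> H1)) (B : set (H2 -> H2))
    (pi : (H1 -> H1) -> (H2 -> H2)) (rho : (H2 -> H2) -> (H3 -> H3)) :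
  unital_rep A pi -> (forall a, A a -> B (pi a)) -> unital_rep B rho ->
  unital_rep A (rho \o pi).
Proof.
move=> [[[_ piL piM] piS] pi1] piB [[[rB rL rM] rS] r1].
split; last by rewrite /= pi1 r1.
split; first split=> [a Aa|c a b Aa Ab|a b Aa Ab] /=.
- by apply: rB; exact: piB.
- by rewrite piL // rL //; exact: piB.
- by rewrite piM // rM //; exact: piB.
- by move=> a Aa /=; rewrite piS // rS //; exact: piB.
Qed.

(** Size 1 is where complete isometry is refuted: it suffices that the norm of a single element
    drops. *)
Lemma mx_opnorm_const H (f : H -> H) :
  mx_opnorm (const_mx f : 'M[H -> H]_1) = opnorm f.
Proof.
have tn (xi : 'I_1 -> H) : tuple_norm xi = rnorm (xi ord0).
  by rewrite /tuple_norm big_ord1 sqrtr_sqr ger0_norm ?rnorm_ge0.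
rewrite /mx_opnorm /opnorm; congr (sup _); apply/seteqP; split=> r /=.
  move=> [xi []]; rewrite !tn big_ord1 mxE => h ->; exists (xi ord0).
  by split=> //; rewrite normE -(rmorph1 (real_complex R)) lecR.
move=> [x []]; rewrite normE -(rmorph1 (real_complex R)) lecR => h ->.
by exists (fun=> x); rewrite !tn big_ord1 mxE.
Qed.

Lemma completely_contractive_opnorm H K (A : set (H -> H))
    (pi : (H -> H) -> (K -> K)) a :
  completely_contractive A pi -> A a -> opnorm (pi a) <= opnorm a.
Proof.
move=> h Aa; rewrite -!mx_opnorm_const -map_const_mx; apply: h => i j.
by rewrite mxE.
Qed.

Lemma completely_isometric_opnorm H K (A : set (H -> H))
    (pi : (H -> H) -> (K -> K)) a :
  completely_isometric A pi -> A a -> opnorm (pi a) = opnorm a.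
Proof.
move=> h Aa; rewrite -!mx_opnorm_const -map_const_mx; apply: h => i j.
by rewrite mxE.
Qed.

End GeneratedAlgebras.

(** * Isometries and Toeplitz-Cuntz families *)

Section Isometries.
Context {R : realType}.
Implicit Types H K : hilbertType R.

Lemma isometryP H (f : H -> H) : bounded_ops H f ->
  isometry f <-> adj f \o f = id.
Proof.
move=> bf; split=> [[_ h]|h].
  have hr x : rnorm (f x) = rnorm x by rewrite /rnorm h.
  apply/funext => x /=; apply: rdot_eq => y; rewrite rdot_adjl //.
  have := hr (x + y); rewrite (linear_opD (bounded_linear bf)).
  move=> /(congr1 (fun r => r ^+ 2)).
  rewrite -!rdotxx !rdotDl !rdotDr !(rdotC y) !(rdotC (f y)) !rdotxx !hr; lra.
split=> // x; rewrite !normE; congr (_%:C); apply/eqP.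
rewrite -(@eqrXn2 _ 2) ?rnorm_ge0 // -!rdotxx rdot_adj // .
by rewrite -[adj f (f x)]/((adj f \o f) x) h.
Qed.

Lemma isometry_adj_comp H (f : H -> H) : isometry f -> adj f \o f = id.
Proof. by move=> hf; apply/isometryP => //; case: hf. Qed.

Lemma isometry_adjK H (f : H -> H) : isometry f -> cancel f (adj f).
Proof. by move=> /isometry_adj_comp h x; rewrite -[LHS]/((adj f \o f) x) h. Qed.

Lemma isometry_rnorm H (f : H -> H) x : isometry f -> rnorm (f x) = rnorm x.
Proof. by case=> _ h; rewrite /rnorm h. Qed.

Lemma unitary_isometry H (f : H -> H) : unitary f -> isometry f.
Proof. by case=> bf h _; apply/isometryP. Qed.

Lemma sum_opE H I (r : seq I) (F : I -> H -> H) x :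
  (\sum_(i <- r) F i) x = \sum_(i <- r) F i x.
Proof. by rewrite fct_sumE. Qed.

Lemma cuntz_toeplitz n H (T : 'I_n -> H -> H) : cuntz T -> toeplitz_cuntz T.
Proof. by move=> [iT sT]; split=> // x; rewrite sT subrr [leRHS]hdot0l. Qed.

(** Test the inequality at T_j x: the j-th term of the sum of |T_k^* T_j x|^2 is already |x|^2 =
    |T_j x|^2, so the other terms vanish. *)
Lemma toeplitz_cuntz_orthogonal n H (T : 'I_n -> H -> H) i j :
  toeplitz_cuntz T -> i != j -> adj (T i) \o T j = 0.
Proof.
move=> [iT sT] ij; apply/funext => x /=; apply: rnorm0_eq0; apply/eqP.
have bT k : bounded_ops H (T k) by case: (iT k).
have := sT (T j x).
rewrite -[(_ - _) _]/(T j x - (\sum_i (T i \o adj (T i))) (T j x)).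
rewrite lecE => /andP[_]; rewrite -[complex.Re '[_, _]]/(rdot _ _) /=.
rewrite rdotDl rdotNl sum_opE rdot_suml rdotxx.
rewrite (eq_bigr (fun k => rnorm (adj (T k) (T j x)) ^+ 2)); last first.
  by move=> k _ /=; rewrite rdot_adj // rdotxx.
rewrite (bigD1 j) //= isometry_adjK // isometry_rnorm // opprD addrA subrr sub0r.
rewrite oppr_ge0 => h; rewrite -sqrf_eq0 eq_le sqr_ge0 andbT (le_trans _ h) //.
rewrite (bigD1 i) //= lerDl sumr_ge0 // => k _; exact: sqr_ge0.
Qed.

End Isometries.

(** * Tensor products *)

Section Tensor.
Context {R : realType} {H1 H2 K : hilbertType R} (t : hilbert_tensor H1 H2 K).
Implicit Types (a : H1 -> H1) (b : H2 -> H2).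

(** The difference d is orthogonal to every sum z of simple tensors; for z within e of d, |d|^2 =
    Re<d, d - z> <= |d| e. *)
Lemma tensor_ext v w :
  (forall x y, '[v, tensor_vec t x y] = '[w, tensor_vec t x y]) -> v = w.
Proof.
move=> h; apply/subr0_eq/rnorm0_eq0/eqP; set d := v - w.
rewrite eq_le rnorm_ge0 andbT; apply: ler_addgt0 => e e0; rewrite add0r.
have [w' [hs [s _ ew]]] : ball d e%:C `&`
    [set \sum_(p <- s) tensor_vec t p.1 p.2 | s in [set: seq (H1 * H2)]] !=set0.
  apply: tensor_vec_dense; last by apply: ball_open; rewrite ltcR.
  by exists d; apply: ballxx; rewrite ltcR.
move: hs; rewrite -ew; set z := \sum_(p <- s) _.
rewrite -ball_normE /= normE ltcR => hz.
have dz : rdot d z = 0.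
  rewrite /rdot /z hdot_sumr big1 // => p _.
  by rewrite /d hdotDl -scaleN1r hdotZl mulN1r h subrr.
have [->|d0] := eqVneq d 0; first by rewrite rnorm0 ltW.
rewrite -rnorm_gt0 in d0.
rewrite -(ler_pM2l d0) -expr2 -rdotxx -[leLHS]subr0 -dz -rdotNr -rdotDr.
by rewrite (le_trans (ler_rdot _ _)) // ler_pM2l // ltW.
Qed.

(** Passing to adjoints moves the operators off the simple tensors, and [tensor_ext] then compares
    the adjoints vector by vector. *)
Lemma tensor_op_ext (f g : K -> K) : bounded_ops K f -> bounded_ops K g ->
  (forall x y, f (tensor_vec t x y) = g (tensor_vec t x y)) -> f = g.
Proof.
move=> bf bg h; rewrite -(adjK bf) -(adjK bg); congr adj.
apply/funext => w; apply: tensor_ext => x y.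
rewrite hdotC [RHS]hdotC; congr Num.conj.
by rewrite -(adjP bf) -(adjP bg) h.
Qed.

Lemma tensor_vec_lin (c : R[i]) x x' y :
  tensor_vec t (c *: x + x') y = c *: tensor_vec t x y + tensor_vec t x' y.
Proof.
by apply: tensor_ext => z z'; rewrite hdot_linear !tensor_vec_dot hdot_linear mulrDl mulrA.
Qed.

Lemma tensor_vecDr x y y' :
  tensor_vec t x (y + y') = tensor_vec t x y + tensor_vec t x y'.
Proof.
by apply: tensor_ext => z z'; rewrite hdotDl !tensor_vec_dot hdotDl mulrDr.
Qed.

Lemma tensor_opM a a' b b' : bounded_ops H1 a -> bounded_ops H1 a' ->
  bounded_ops H2 b -> bounded_ops H2 b' ->
  tensor_op t a b \o tensor_op t a' b' = tensor_op t (a \o a') (b \o b').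
Proof.
move=> ba ba' bb bb'.
have [baa bbb] := (bounded_comp ba ba', bounded_comp bb bb').
apply: tensor_op_ext => [||x y].
- by apply: bounded_comp; exact: tensor_op_bounded.
- exact: tensor_op_bounded.
- by rewrite /= !tensor_op_vec.
Qed.

Lemma tensor_op_adj a b : bounded_ops H1 a -> bounded_ops H2 b ->
  adj (tensor_op t a b) = tensor_op t (adj a) (adj b).
Proof.
move=> ba bb; have [ba' bb'] := (bounded_adj ba, bounded_adj bb).
have bt := tensor_op_bounded t ba bb.
apply: tensor_op_ext => [||x y]; [exact: bounded_adj|exact: tensor_op_bounded|].
apply: tensor_ext => z z'; rewrite tensor_op_vec // tensor_vec_dot.
rewrite (is_adjointC (adjP bt)) tensor_op_vec // tensor_vec_dot.
by rewrite (is_adjointC (adjP ba)) (is_adjointC (adjP bb)).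
Qed.

Lemma tensor_op_id : tensor_op t id id = id.
Proof.
apply: tensor_op_ext; [|exact: bounded_id|] => [|x y].
  exact: tensor_op_bounded (bounded_id _) (bounded_id _).
by rewrite tensor_op_vec //; exact: bounded_id.
Qed.

Lemma tensor_op_lin (c : R[i]) a a' b : bounded_ops H1 a -> bounded_ops H1 a' ->
  bounded_ops H2 b ->
  tensor_op t (c *: a + a') b = c *: tensor_op t a b + tensor_op t a' b.
Proof.
move=> ba ba' bb; have bl := bounded_lin c ba ba'.
apply: tensor_op_ext => [||x y]; first exact: tensor_op_bounded.
  by apply: bounded_lin; exact: tensor_op_bounded.
rewrite tensor_op_vec // -[RHS]/(c *: tensor_op t a b _ + tensor_op t a' b _).
by rewrite !tensor_op_vec // -tensor_vec_lin.
Qed.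

Lemma tensor_opDr a b b' : bounded_ops H1 a -> bounded_ops H2 b ->
  bounded_ops H2 b' ->
  tensor_op t a (b + b') = tensor_op t a b + tensor_op t a b'.
Proof.
move=> ba bb bb'.
have bD : bounded_ops H2 (b + b') by rewrite -[b]scale1r; exact: bounded_lin.
apply: tensor_op_ext => [||x y]; first exact: tensor_op_bounded.
  by rewrite -[tensor_op t a b]scale1r; apply: bounded_lin; exact: tensor_op_bounded.
rewrite tensor_op_vec // -[RHS]/(tensor_op t a b _ + tensor_op t a b' _).
by rewrite !tensor_op_vec // -tensor_vecDr.
Qed.

Lemma tensor_op0r a : bounded_ops H1 a -> tensor_op t a 0 = 0.
Proof.
move=> ba; have b0 := bounded_0 H2.
apply: (addrI (tensor_op t a 0)).
by rewrite -tensor_opDr // !addr0.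
Qed.

Lemma tensor_op_sumr I (r : seq I) a (b : I -> H2 -> H2) : bounded_ops H1 a ->
  (forall i, bounded_ops H2 (b i)) ->
  tensor_op t a (\sum_(i <- r) b i) = \sum_(i <- r) tensor_op t a (b i).
Proof.
move=> ba bb; elim: r => [|i r IHr]; first by rewrite !big_nil tensor_op0r.
rewrite !big_cons tensor_opDr ?IHr //.
by apply: opalg_sum => //; case: (bounded_ops_cstar H2).
Qed.

Lemma tensor_op_rep : unital_rep (bounded_ops H1) (fun a => tensor_op t a id).
Proof.
have bi := bounded_id H2.
split; last exact: tensor_op_id.
split; first split=> [a ba|c a b ba bb|a b ba bb].
- exact: tensor_op_bounded.
- exact: tensor_op_lin.
- by rewrite tensor_opM.
- by move=> a ba; rewrite tensor_op_adj // adj_id.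
Qed.

Lemma tensor_rep (H0 : hilbertType R) (A : set (H0 -> H0))
    (pi : (H0 -> H0) -> (H1 -> H1)) :
  unital_rep A pi -> unital_rep A (fun x => tensor_op t (pi x) id).
Proof.
move=> hpi; apply: (unital_rep_comp hpi _ tensor_op_rep) => a.
exact: (rep_bounded hpi).
Qed.

Lemma tensor_isometry a b : isometry a -> isometry b ->
  isometry (tensor_op t a b).
Proof.
move=> ia ib; have [[ba _] [bb _]] := (ia, ib).
have [ba' bb'] := (bounded_adj ba, bounded_adj bb).
apply/isometryP; first exact: tensor_op_bounded.
by rewrite tensor_op_adj // tensor_opM // !isometry_adj_comp // tensor_op_id.
Qed.

Lemma tensor_cuntz n (U : H1 -> H1) (T : 'I_n -> H2 -> H2) : unitary U ->
  cuntz T -> cuntz (fun i => tensor_op t U (T i)).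
Proof.
move=> uU [iT sT]; have iU := unitary_isometry uU; have [bU _ UU] := uU.
have bT i : bounded_ops H2 (T i) by case: (iT i).
split; first by move=> i; exact: tensor_isometry.
rewrite -(tensor_op_id) -sT tensor_op_sumr.
- apply: eq_bigr => i _; rewrite tensor_op_adj // tensor_opM ?UU //; exact: bounded_adj.
- exact: bounded_id.
- by move=> i; apply: bounded_comp => //; exact: bounded_adj.
Qed.

End Tensor.

(** * The endomorphism of the Cuntz algebra *)

Section CuntzEndomorphism.
Context {R : realType} {n : nat} {H0 : hilbertType R} (S : 'I_n -> H0 -> H0).
Context (hS : cuntz S).

Let iS := hS.1.

Let bS i : bounded_ops H0 (S i).
Proof. by case: (iS i). Qed.

Lemma cuntz_algebra_cstar : cstar_algebra (cuntz_algebra S).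
Proof. by apply: cstar_gen_cstar => j _. Qed.

Let oA := cstar_opalg cuntz_algebra_cstar.

Lemma cuntz_algebra_gen i : cuntz_algebra S (S i).
Proof. exact: cstar_gen_in. Qed.

Lemma cuntz_algebra_gen_adj i : cuntz_algebra S (adj (S i)).
Proof. exact: (cstar_adj cuntz_algebra_cstar (cuntz_algebra_gen i)). Qed.

Lemma cuntz_algebra_id : cuntz_algebra S id.
Proof.
rewrite -hS.2; apply: (opalg_sum oA) => i.
by apply: (opalg_comp oA); [exact: cuntz_algebra_gen|exact: cuntz_algebra_gen_adj].
Qed.

Lemma cuntz_endo_algebra x : cuntz_algebra S x ->
  cuntz_algebra S (cuntz_endo S x).
Proof.
move=> Ax; apply: (opalg_sum oA) => i.
apply: (opalg_comp oA); last exact: cuntz_algebra_gen_adj.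
by apply: (opalg_comp oA) => //; exact: cuntz_algebra_gen.
Qed.

Lemma cuntz_endoE x z :
  cuntz_endo S x z = \sum_(i < n) S i (x (adj (S i) z)).
Proof. by rewrite /cuntz_endo sum_opE. Qed.

(** The relation S_i^* alpha(x) = x S_i^* yields multiplicativity of alpha, and injectivity through
    x = S_i^* alpha(x) S_i. *)
Lemma adj_cuntz_endo i x z : bounded_ops H0 x ->
  adj (S i) (cuntz_endo S x z) = x (adj (S i) z).
Proof.
move=> bx; rewrite cuntz_endoE.
rewrite (linear_op_sum _ _ _ (bounded_linear (bounded_adj (bS i)))).
rewrite (bigD1 i) //= isometry_adjK // big1 ?addr0 // => j ji.
rewrite -[LHS]/((adj (S i) \o S j) _) toeplitz_cuntz_orthogonal //.
  exact: cuntz_toeplitz.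
by rewrite eq_sym.
Qed.

Lemma cuntz_endo_id : cuntz_endo S id = id.
Proof. by rewrite -[RHS]hS.2. Qed.

Lemma cuntz_endo_star_hom :
  star_hom (cuntz_algebra S) (cuntz_algebra S) (cuntz_endo S).
Proof.
split; first split=> [x Ax|c x y Ax Ay|x y Ax Ay].
- exact: cuntz_endo_algebra.
- apply/funext => z.
  rewrite -[RHS]/(c *: cuntz_endo S x z + cuntz_endo S y z).
  rewrite !cuntz_endoE scaler_sumr -big_split /=; apply: eq_bigr => i _.
  by rewrite -[(_ + _) _]/(c *: x _ + y _) (bounded_linear (bS i)).
- apply/funext => z /=; rewrite [LHS]cuntz_endoE [RHS]cuntz_endoE.
  apply: eq_bigr => i _ /=.
  by rewrite adj_cuntz_endo //; exact: opalg_bounded Ay.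
move=> x Ax; have bx := opalg_bounded oA Ax.
symmetry; apply: adjE => y z; rewrite !cuntz_endoE hdot_suml hdot_sumr.
apply: eq_bigr => i _.
by rewrite (adjP (bS i)) (adjP bx) (is_adjointC (adjP (bS i))).
Qed.

Lemma cuntz_endo_inj (i : 'I_n) : set_inj (cuntz_algebra S) (cuntz_endo S).
Proof.
move=> x y /set_mem Ax /set_mem Ay e; apply/funext => z.
have := adj_cuntz_endo i (S i z) (opalg_bounded oA Ax).
rewrite e adj_cuntz_endo; last exact: opalg_bounded Ay.
by rewrite isometry_adjK.
Qed.

Lemma cuntz_identity_pair : covariant_pair (cuntz_algebra S) (cuntz_endo S) id S.
Proof.
split; [|exact: cuntz_toeplitz|by []].
by split=> //; split=> //; split=> // x; exact: opalg_bounded.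
Qed.

(** The summands c_i = pi(S_i^* ) V (x) T_i have orthogonal ranges, because T_i^* T_j = 0 in the
    second leg, and the c_i^* c_i add up to V^* pi(1) V (x) 1 = 1, because the S_i S_i^* add up to 1
    in the first. A general isometry V covers both the unitary of (b) and the isometry of (c). *)
Lemma tensor_cuntz_sum_norm_bound (H1 H2 K : hilbertType R)
    (t : hilbert_tensor H1 H2 K) (pi : (H0 -> H0) -> (H1 -> H1))
    (V : H1 -> H1) (T : 'I_n -> H2 -> H2) :
  unital_rep (cuntz_algebra S) pi -> isometry V -> toeplitz_cuntz T ->
  norm_bound (\sum_i (tensor_op t (pi (adj (S i))) id \o tensor_op t V (T i))) 1.
Proof.
move=> hpi iV hT.
have bV : bounded_ops H1 V by case: iV.
have bV' := bounded_adj bV.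
have bT i : bounded_ops H2 (T i) by case: (hT.1 i).
have bi := bounded_id H2.
have bp i : bounded_ops H1 (pi (adj (S i))).
  by apply: (rep_bounded hpi); exact: cuntz_algebra_gen_adj.
have bpV i : bounded_ops H1 (pi (adj (S i)) \o V) by exact: bounded_comp.
pose c i := tensor_op t (pi (adj (S i)) \o V) (T i).
have bc i : bounded_ops K (c i) by exact: tensor_op_bounded.
have -> : \sum_i (tensor_op t (pi (adj (S i))) id \o tensor_op t V (T i)) =
    \sum_i c i.
  by apply: eq_bigr => i _; rewrite tensor_opM.
have cc i j : adj (c i) \o c j =
    tensor_op t (adj (pi (adj (S i)) \o V) \o (pi (adj (S j)) \o V))
      (adj (T i) \o T j).
  by rewrite tensor_op_adj // tensor_opM //; exact: bounded_adj.
have c0 i j : i != j -> adj (c i) \o c j = 0.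
  move=> ij; rewrite cc toeplitz_cuntz_orthogonal // tensor_op0r //.
  by apply: bounded_comp => //; exact: bounded_adj.
have c1 : \sum_i (adj (c i) \o c i) = id.
  transitivity (\sum_i tensor_op t (adj V \o pi (S i \o adj (S i)) \o V) id).
    apply: eq_bigr => i _; rewrite cc (isometry_adj_comp (hT.1 i)).
    rewrite adjM // -(rep_adj hpi); last exact: cuntz_algebra_gen_adj.
    rewrite adjK // (alg_homM hpi.1.1) //; first exact: cuntz_algebra_gen.
    exact: cuntz_algebra_gen_adj.
  have AS i : cuntz_algebra S (S i \o adj (S i)).
    by apply: (opalg_comp oA); [exact: cuntz_algebra_gen|exact: cuntz_algebra_gen_adj].
  rewrite -(alg_hom_sum _ (tensor_op_rep t).1.1); last 2 first.
  - by case: (bounded_ops_cstar H1).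
  - move=> i; apply: bounded_comp => //; apply: bounded_comp => //.
    exact: (rep_bounded hpi).
  rewrite -[RHS](tensor_op_id t); congr (tensor_op t _ id).
  rewrite -[RHS](isometry_adj_comp iV); apply/funext => x.
  have e : \sum_i pi (S i \o adj (S i)) = id.
    by rewrite -(alg_hom_sum oA hpi.1.1) // hS.2 hpi.2.
  transitivity (adj V ((\sum_i pi (S i \o adj (S i))) (V x))); last by rewrite e.
  by rewrite !sum_opE (linear_op_sum _ _ _ (bounded_linear bV')).
move=> z; rewrite mul1r; apply: ler_rnorm_sqr; first exact: rnorm_ge0.
rewrite sum_opE rdot_suml.
rewrite (eq_bigr (fun i => rdot ((adj (c i) \o c i) z) z)); last first.
  move=> i _; rewrite rdotC rdot_suml (bigD1 i) //= big1.
    by rewrite addr0 rdot_adjl.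
  move=> j ji; rewrite rdotC -rdot_adjl // -[adj _ _]/((adj (c j) \o c i) z).
  by rewrite c0 // rdot0l.
by rewrite -rdot_suml -(sum_opE _ (fun i => adj (c i) \o c i)) c1 rdotxx.
Qed.

End CuntzEndomorphism.

(** * Boundedness of covariant families *)

Section CovariantFamilies.
Context {R : realType} {n : nat} {H0 : hilbertType R}.
Implicit Types H K : hilbertType R.
Context (A : set (H0 -> H0)) (alpha : (H0 -> H0) -> (H0 -> H0)).

Lemma word_in H (T : 'I_n -> H -> H) (B : set (H -> H)) mu :
  operator_algebra B -> B id -> (forall i, B (T i)) -> B (word T mu).
Proof.
by move=> oB Bid BT; elim: mu => //= i mu IH; exact: (opalg_comp oB).
Qed.

Lemma covariant_gens_bounded H (u : (H0 -> H0) + 'I_n -> H -> H) :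
  covariant_gens A alpha u ->
  forall j, with_gens A 'I_n j -> bounded_ops H (u j).
Proof.
move=> [pi [T [[hpi [iT _] _] ->]]] [x Ax|i _] /=; last by case: (iT i).
exact: (rep_bounded hpi).
Qed.

Lemma covariant_word_gens_bounded H (u : (H0 -> H0) + seq 'I_n -> H -> H) :
  covariant_word_gens A alpha u ->
  forall j, with_gens A (seq 'I_n) j -> bounded_ops H (u j).
Proof.
move=> [pi [T [[hpi [iT _] _] ->]]] [x Ax|mu _] /=.
  exact: (rep_bounded hpi).
apply: word_in => [||i]; [by case: (bounded_ops_cstar H)|exact: bounded_id|].
by case: (iT i).
Qed.

End CovariantFamilies.

(** * The norm of the witness in the semicrossed product *)

Section SemicrossedNorms.
Context {R : realType} {n : nat} {H0 : hilbertType R} (S : 'I_n -> H0 -> H0).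
Context (hS : cuntz S).
Local Notation A := (cuntz_algebra S).
Local Notation alpha := (cuntz_endo S).

Definition cuntz_sum (H : hilbertType R)
    (u : (H0 -> H0) + seq 'I_n -> H -> H) : H -> H :=
  \sum_i (u (inl (adj (S i))) \o u (inr [:: i])).

(** The only adjoints in the sum are the S_i^*, which are elements of A and hence index
    generators. *)
Lemma cuntz_sum_in (HT : hilbertType R)
    (uT : (H0 -> H0) + seq 'I_n -> HT -> HT) :
  (forall j, with_gens A (seq 'I_n) j -> bounded_ops HT (uT j)) ->
  opalg_gen (with_gens A (seq 'I_n)) uT (cuntz_sum uT).
Proof.
move=> buT; have oAT := opalg_gen_opalg buT.
apply: (opalg_sum oAT) => i; apply: (opalg_comp oAT); apply: opalg_gen_in => //.
exact: cuntz_algebra_gen_adj.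
Qed.

Lemma alg_hom_cuntz_sum (HT K : hilbertType R)
    (uT : (H0 -> H0) + seq 'I_n -> HT -> HT) (B : set (K -> K))
    (v : (H0 -> H0) + seq 'I_n -> K -> K) (Phi : (HT -> HT) -> (K -> K)) :
  (forall j, with_gens A (seq 'I_n) j -> bounded_ops HT (uT j)) ->
  alg_hom (opalg_gen (with_gens A (seq 'I_n)) uT) B Phi ->
  intertwines (with_gens A (seq 'I_n)) uT v Phi ->
  Phi (cuntz_sum uT) = cuntz_sum v.
Proof.
move=> buT hom itw; have oAT := opalg_gen_opalg buT.
have Al i : with_gens A (seq 'I_n) (inl (adj (S i))).
  exact: cuntz_algebra_gen_adj.
rewrite (alg_hom_sum oAT hom) => [|i]; last first.
  by apply: (opalg_comp oAT); apply: opalg_gen_in.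
apply: eq_bigr => i _; rewrite (alg_homM hom); [|exact: opalg_gen_in..].
by rewrite !itw.
Qed.

Lemma semicrossed_cuntz_sum_opnorm (HT : hilbertType R)
    (uT : (H0 -> H0) + seq 'I_n -> HT -> HT) :
  (exists x : H0, x != 0) -> universal_semicrossed A alpha uT ->
  n%:R <= opnorm (cuntz_sum uT).
Proof.
move=> [x x0] [PuT univ]; have buT := covariant_word_gens_bounded PuT.
have [Psi [hom cc itw]] := univ H0 _
  (ex_intro _ id (ex_intro _ S (conj (cuntz_identity_pair hS) erefl))).
have := completely_contractive_opnorm cc (cuntz_sum_in buT).
apply: le_trans; rewrite (alg_hom_cuntz_sum buT hom itw).
have e z : cuntz_sum (pair_gens id (word S)) z = (n%:R)%:C *: z.
  rewrite /cuntz_sum sum_opE rmorph_nat (eq_bigr (fun=> z)).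
    by rewrite sumr_const card_ord scaler_nat.
  by move=> i _ /=; rewrite isometry_adjK //; exact: hS.1.
set f := cuntz_sum _ in e *.
have bf : bounded_ops H0 f.
  apply: (@norm_bound_bounded _ _ _ n%:R) => [c y z|y].
    by rewrite !e scalerDr !scalerA mulrC.
  by rewrite e rnormZr ger0_norm.
rewrite -rnorm_gt0 in x0.
rewrite -(ler_pM2r x0) (le_trans _ (opnormP bf x)) //.
by rewrite e rnormZr ger0_norm.
Qed.

End SemicrossedNorms.

(** * The twisted crossed product *)

Section TwistedCrossedProduct.
Context {R : realType} {n : nat} {H0 : hilbertType R} (S : 'I_n -> H0 -> H0).
Context (hS : cuntz S).
Local Notation A := (cuntz_algebra S).
Local Notation alpha := (cuntz_endo S).
Context {Hinf : hilbertType R} (iota : nat * (H0 -> H0) -> Hinf -> Hinf).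
Context (hiota : cocone A alpha iota).
Context (alphainf : (Hinf -> Hinf) -> (Hinf -> Hinf)).
Context (halphainf : induced_automorphism A alpha iota alphainf).
Context {H1 : hilbertType R} (sigma : (Hinf -> Hinf) -> (H1 -> H1)).
Context (U : H1 -> H1).
Context (hsigma : unital_rep (direct_limit A iota) sigma).
Context (hU : unitary U).
Context (hcov : forall x, direct_limit A iota x ->
  U \o sigma x \o adj U = sigma (alphainf x)).
Context {H2 : hilbertType R} (T : 'I_n -> H2 -> H2).
Context (hT : cuntz T).
Context {K : hilbertType R} (t : hilbert_tensor H1 H2 K).

Let pi' x := tensor_op t (sigma (iota (0%N, x))) id.
Let T' i := tensor_op t U (T i).
Let bU : bounded_ops H1 U. Proof. by case: hU. Qed.
Let bT i : bounded_ops H2 (T i). Proof. by case: (hT.1 i). Qed.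

Lemma iota_bounded j : direct_limit_index A j -> bounded_ops Hinf (iota j).
Proof. by case: j => k x Ax; apply: (rep_bounded (hiota k).1 Ax). Qed.

Lemma direct_limit_in k x : A x -> direct_limit A iota (iota (k, x)).
Proof. by move=> Ax; apply: cstar_gen_in. Qed.

Lemma direct_limit_id : direct_limit A iota id.
Proof.
rewrite -(hiota 0%N).1.2; apply: direct_limit_in.
exact: cuntz_algebra_id.
Qed.

Lemma sigma_iota_rep k : unital_rep A (fun x => sigma (iota (k, x))).
Proof.
apply: (unital_rep_comp (hiota k).1 _ hsigma) => x; exact: direct_limit_in.
Qed.

(** Conjugating sigma(x) (x) 1 by the U (x) T_i and summing gives U sigma(x) U^* in the first leg
    and, as T is a Cuntz family, 1 in the second; the first is sigma of the image of x under the
    induced automorphism, which extends alpha. *)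
Lemma twisted_covariant_pair : covariant_pair A alpha pi' T'.
Proof.
have bi := bounded_id H2.
have bs x : A x -> bounded_ops H1 (sigma (iota (0%N, x))).
  by move=> Ax; exact: (rep_bounded (sigma_iota_rep 0) Ax).
split; first exact: tensor_rep (sigma_iota_rep 0).
  by apply: cuntz_toeplitz; exact: tensor_cuntz.
move=> x Ax; rewrite /pi' /T'.
have [_ _ aiota] := halphainf.
rewrite -aiota // -hcov; last exact: direct_limit_in.
rewrite -[X in tensor_op _ _ X = _]hT.2 tensor_op_sumr.
- apply: eq_bigr => i _; have bx := bs x Ax.
  have [bU' bT'] := (bounded_adj bU, bounded_adj (bT i)).
  by rewrite tensor_op_adj // !tensor_opM //; exact: bounded_comp.
- by apply: bounded_comp; [apply: bounded_comp => //; exact: bs|exact: bounded_adj].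
- by move=> i; apply: bounded_comp => //; exact: bounded_adj.
Qed.

Lemma twisted_gens_bounded j : with_gens (direct_limit A iota) 'I_n j ->
  bounded_ops K (pair_gens (fun x => tensor_op t (sigma x) id) T' j).
Proof.
case: j => [x Ax|i _] /=; apply: tensor_op_bounded => //; last exact: bounded_id.
exact: (rep_bounded hsigma).
Qed.

Local Notation Atw := (twisted_crossed (direct_limit A iota) t sigma U T).

Lemma twisted_crossed_cstar : cstar_algebra Atw.
Proof. exact: cstar_gen_cstar twisted_gens_bounded. Qed.

Lemma twisted_crossed_pi x : A x -> Atw (pi' x).
Proof.
move=> Ax.
apply: (@cstar_gen_in R _ (with_gens (direct_limit A iota) 'I_n) _
  (pair_gens (fun x => tensor_op t (sigma x) id) T') (inl (iota (0%N, x)))).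
exact: direct_limit_in.
Qed.

Lemma twisted_crossed_T i : Atw (T' i).
Proof.
exact: (@cstar_gen_in R _ (with_gens (direct_limit A iota) 'I_n) _
  (pair_gens (fun x => tensor_op t (sigma x) id) T') (inr i)).
Qed.

Lemma twisted_crossed_id : Atw id.
Proof.
have <- : pi' id = id by exact: (tensor_rep t (sigma_iota_rep 0)).2.
exact: twisted_crossed_pi (cuntz_algebra_id hS).
Qed.

(* Compression by T'_i turns sigma(iota_k x) (x) 1 into sigma(iota_(k+1) x) (x) 1. *)
Lemma twisted_crossed_sub (i0 : 'I_n) (B : set (K -> K)) : cstar_algebra B ->
  (forall x, A x -> B (pi' x)) -> (forall i, B (T' i)) -> Atw `<=` B.
Proof.
move=> hB Bpi BT; apply: cstar_gen_sub => // -[x Ax|i _] /=; last exact: BT.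
have [_ _ aiota] := halphainf.
have hrep := tensor_rep t hsigma.
(* Induction over the direct limit: only the images of the finite levels remain. *)
move: x Ax; apply: (rep_cstar_gen_sub iota_bounded direct_limit_id hrep hB).
move=> [k x] Ax; rewrite /direct_limit_index /= in Ax.
have iU := unitary_isometry hU.
elim: k => [|k IHk]; first exact: Bpi.
have Lk := direct_limit_in k Ax; have Lk1 := direct_limit_in k.+1 Ax.
have -> : tensor_op t (sigma (iota (k.+1, x))) id =
    adj (T' i0) \o tensor_op t (sigma (iota (k, x))) id \o T' i0.
  (* iota_k(x) = iota_(k+1)(alpha(x)) is the image of iota_(k+1)(x) under the automorphism, which U
     implements. *)
  have e : sigma (iota (k, x)) = U \o sigma (iota (k.+1, x)) \o adj U.
    by rewrite hcov // aiota // (hiota k).2.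
  have bs l : bounded_ops H1 (sigma (iota (l, x))).
    exact: (rep_bounded (sigma_iota_rep l)).
  have bU' := bounded_adj bU.
  have bT' := bounded_adj (bT i0).
  have bi := bounded_id H2.
  rewrite /T' tensor_op_adj // !tensor_opM //; [|exact: bounded_comp..].
  rewrite -[adj (T i0) \o id \o T i0]/(adj (T i0) \o T i0).
  rewrite isometry_adj_comp; last exact: hT.1.
  congr (tensor_op t _ id); rewrite e; apply/funext => y /=.
  by rewrite !isometry_adjK.
have oB := cstar_opalg hB.
apply: (opalg_comp oB) => //; apply: (opalg_comp oB) => //.
exact: cstar_adj hB (BT i0).
Qed.

Lemma canonical_star_hom (i0 i1 : 'I_n) (HN : hilbertType R)
    (uN : (H0 -> H0) + 'I_n -> HN -> HN) :
  i0 != i1 -> (exists x : H0, x != 0) -> universal_covariant A alpha uN ->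
  let AN := cstar_gen (with_gens A 'I_n) uN in
  exists Phi : (HN -> HN) -> (K -> K),
    [/\ star_hom AN Atw Phi,
        intertwines (with_gens A 'I_n) uN (pair_gens pi' T') Phi,
        set_surj AN Atw Phi &
        ~ set_inj AN Phi].
Proof.
move=> i01 [x0 x0n] [PuN univ] AN; have buN := covariant_gens_bounded PuN.
have hAN := cstar_gen_cstar buN; have oAN := cstar_opalg hAN.
have Aid := cuntz_algebra_id hS.
have uN1 : uN (inl id) = id.
  by case: PuN => pi [V [[[_ h] _ _] ->]].
have ANid : AN id by rewrite -uN1; apply: cstar_gen_in.
have ANi i : AN (uN (inr i)) by apply: cstar_gen_in.
have ANx x : A x -> AN (uN (inl x)) by move=> Ax; apply: cstar_gen_in.
have [Phi [sPhi iPhi]] := univ K _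
  (ex_intro _ pi' (ex_intro _ T' (conj twisted_covariant_pair erefl))).
have Pr i : Phi (uN (inr i)) = T' i by rewrite iPhi.
have Pl x : A x -> Phi (uN (inl x)) = pi' x by move=> Ax; rewrite iPhi.
have rPhi : unital_rep AN Phi.
  split=> //; rewrite -{1}uN1 Pl //.
  exact: (tensor_rep t (sigma_iota_rep 0)).2.
have PhiAtw a : AN a -> Atw (Phi a).
  apply: (rep_cstar_gen_sub buN ANid rPhi twisted_crossed_cstar).
  move=> [x Ax|i _]; first by rewrite Pl //; exact: twisted_crossed_pi.
  by rewrite Pr; exact: twisted_crossed_T.
exists Phi; split=> //.
- by case: sPhi => -[_ h1 h2] h3; split=> //; split.
(* The range of Phi is a C*-algebra containing level 0 and the T'_i, from which the compressions
   recover all higher levels. *)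
- apply: (twisted_crossed_sub i0); first exact: rep_image_cstar.
    by move=> x Ax; exists (uN (inl x)); [exact: ANx|rewrite Pl].
  by move=> i; exists (uN (inr i)); rewrite // Pr.
move=> inj.
have AS i : A (S i) by exact: cuntz_algebra_gen.
have AS' i : A (adj (S i)) by exact: cuntz_algebra_gen_adj.
have Ae : A (S i0 \o adj (S i1)).
  by apply: (opalg_comp (cstar_opalg (cuntz_algebra_cstar hS))).
pose e := adj (uN (inr i0)) \o (uN (inl (S i0 \o adj (S i1))) \o uN (inr i1)).
have Ae1 : AN (uN (inl (S i0 \o adj (S i1))) \o uN (inr i1)).
  exact: (opalg_comp oAN (ANx _ Ae) (ANi i1)).
have Ai0 : AN (adj (uN (inr i0))) by exact: (cstar_adj hAN (ANi i0)).
have ANe : AN e by exact: (opalg_comp oAN Ai0 Ae1).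
have e0 : e = 0.
  apply: inj; [exact/mem_set|apply/mem_set; exact: opalg0|].
  rewrite (alg_hom0 oAN sPhi.1) (alg_homM sPhi.1 Ai0 Ae1) (sPhi.2 _ (ANi i0)).
  rewrite (alg_homM sPhi.1 (ANx _ Ae) (ANi i1)).
  rewrite !Pr Pl // /pi' /T'.
  have bs : bounded_ops H1 (sigma (iota (0%N, S i0 \o adj (S i1)))).
    exact: (rep_bounded (sigma_iota_rep 0)).
  have bi := bounded_id H2.
  have [bU' bT'] := (bounded_adj bU, bounded_adj (bT i0)).
  rewrite tensor_op_adj // !tensor_opM //; [|exact: bounded_comp..].
  rewrite -[adj (T i0) \o (id \o T i1)]/(adj (T i0) \o T i1).
  rewrite toeplitz_cuntz_orthogonal //; last exact: cuntz_toeplitz.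
  by apply: tensor_op0r; do 2 apply: bounded_comp => //.
have [Psi [sPsi iPsi]] := univ H0 _
  (ex_intro _ id (ex_intro _ S (conj (cuntz_identity_pair hS) erefl))).
have : Psi e = id.
  rewrite (alg_homM sPsi.1 Ai0 Ae1) (sPsi.2 _ (ANi i0)).
  rewrite (alg_homM sPsi.1 (ANx _ Ae) (ANi i1)).
  rewrite !iPsi //=; apply/funext => x /=.
  by rewrite !isometry_adjK //; exact: hS.1.
rewrite e0 (alg_hom0 oAN sPsi.1) => /(congr1 (@^~ x0)) /esym/eqP.
by apply/negP.
Qed.

Lemma canonical_alg_hom (HT : hilbertType R)
    (uT : (H0 -> H0) + seq 'I_n -> HT -> HT) :
  (2 <= n)%N -> (exists x : H0, x != 0) -> universal_semicrossed A alpha uT ->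
  let AT := opalg_gen (with_gens A (seq 'I_n)) uT in
  exists Phi : (HT -> HT) -> (K -> K),
    [/\ alg_hom AT Atw Phi,
        intertwines (with_gens A (seq 'I_n)) uT (pair_gens pi' (word T')) Phi,
        completely_contractive AT Phi &
        ~ completely_isometric AT Phi].
Proof.
move=> n2 x0 hu AT; have [PuT univ] := hu.
have buT := covariant_word_gens_bounded PuT.
have oAT := opalg_gen_opalg buT.
have [Phi [hom cc itw]] := univ K _
  (ex_intro _ pi' (ex_intro _ T' (conj twisted_covariant_pair erefl))).
have oAtw := cstar_opalg twisted_crossed_cstar.
(* Universality only places the values in B(K); complete contractivity at size 1 lets the preimage
   argument place them in the twisted crossed product. *)
have PhiAtw : AT `<=` [set a | AT a /\ Atw (Phi a)].
  apply: opalg_gen_sub.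
    apply: (preimage_opalg oAT oAtw hom) => a m Aa m0 hm.
    apply: norm_bound_le (opnormP (alg_hom_fun hom Aa)) _.
    exact: le_trans (completely_contractive_opnorm cc Aa) (opnorm_le m0 hm).
  move=> j hj; split; first exact: opalg_gen_in.
  rewrite itw //; case: j hj => [x Ax|mu _] /=; first exact: twisted_crossed_pi.
  by apply: word_in => //; [exact: twisted_crossed_id|exact: twisted_crossed_T].
exists Phi; split=> //.
  by case: hom => _ h1 h2; split=> // a /PhiAtw[].
move=> ci; have := completely_isometric_opnorm ci (cuntz_sum_in hS buT).
rewrite (alg_hom_cuntz_sum hS buT hom itw) => e.
have := semicrossed_cuntz_sum_opnorm hS x0 hu; rewrite -e => h.
have n1 : (n <= 1)%N.
  rewrite -(ler_nat R); apply: (le_trans h); apply: opnorm_le => //.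
  apply: (tensor_cuntz_sum_norm_bound hS t (sigma_iota_rep 0)).
    exact: unitary_isometry.
  exact: cuntz_toeplitz.
by rewrite leqNgt n2 in n1.
Qed.

End TwistedCrossedProduct.

(** The obstruction is a norm gap: the witness has norm at least n >= 2 in the source and at most 1
    in every tensor family, so it excludes every completely isometric intertwiner, bijective or
    not. *)
Lemma semicrossed_not_isometric_tensor (R : realType) (n : nat)
    (H0 : hilbertType R) (S : 'I_n -> H0 -> H0) (HT Ht : hilbertType R)
    (uT : (H0 -> H0) + seq 'I_n -> HT -> HT)
    (ut : (H0 -> H0) + seq 'I_n -> Ht -> Ht) (Phi : (HT -> HT) -> (Ht -> Ht)) :
  cuntz S -> (2 <= n)%N -> (exists x : H0, x != 0) ->
  universal_semicrossed (cuntz_algebra S) (cuntz_endo S) uT ->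
  tensor_word_gens (cuntz_algebra S) (cuntz_endo S) ut ->
  let J := with_gens (cuntz_algebra S) (seq 'I_n) in
  alg_hom (opalg_gen J uT) (opalg_gen J ut) Phi -> intertwines J uT ut Phi ->
  ~ completely_isometric (opalg_gen J uT) Phi.
Proof.
move=> hS n2 x0 hu [H1 [H2 [t [pi [V [T [[hpi iV _ hT] ->]]]]]]] J hom itw ci.
have buT := covariant_word_gens_bounded hu.1.
have := completely_isometric_opnorm ci (cuntz_sum_in hS buT).
rewrite (alg_hom_cuntz_sum hS buT hom itw) => e.
have := semicrossed_cuntz_sum_opnorm hS x0 hu; rewrite -e => h.
have n1 : (n <= 1)%N.
  rewrite -(ler_nat R); apply: (le_trans h); apply: opnorm_le => //.
  exact: (tensor_cuntz_sum_norm_bound hS t hpi iV hT).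
by rewrite leqNgt n2 in n1.
Qed.
Theorem mainTheorem10 (R : realType) (n : nat) (hn : (2 <= n)%N)
    (* A = O_n with its generators S *)
    (H0 : hilbertType R) (S : 'I_n -> H0 -> H0) (hS : cuntz_generators S)
    (* A_infty with its automorphism *)
    (Hinf : hilbertType R) (iota : nat * (H0 -> H0) -> Hinf -> Hinf)
    (hiota : is_direct_limit (cuntz_algebra S) (cuntz_endo S) iota)
    (alphainf : (Hinf -> Hinf) -> (Hinf -> Hinf))
    (halphainf :
      induced_automorphism (cuntz_algebra S) (cuntz_endo S) iota alphainf)
    (* the crossed product of A_infty by Z *)
    (H1 : hilbertType R) (sigma : (Hinf -> Hinf) -> (H1 -> H1)) (U : H1 -> H1)
    (hsigmaU : universal_unitary_pair
      (direct_limit (cuntz_algebra S) iota) alphainf sigma U)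
    (* O_n as the second tensor factor *)
    (H2 : hilbertType R) (T : 'I_n -> H2 -> H2) (hT : cuntz_generators T)
    (K : hilbertType R) (t : hilbert_tensor H1 H2 K)
    (* the universal C*-algebra and the two universal operator algebras *)
    (HN : hilbertType R) (uN : (H0 -> H0) + 'I_n -> HN -> HN)
    (huN : universal_covariant (cuntz_algebra S) (cuntz_endo S) uN)
    (HT : hilbertType R) (uT : (H0 -> H0) + seq 'I_n -> HT -> HT)
    (huT : universal_semicrossed (cuntz_algebra S) (cuntz_endo S) uT)
    (Ht : hilbertType R) (ut : (H0 -> H0) + seq 'I_n -> Ht -> Ht)
    (hut : universal_tensor_semicrossed (cuntz_algebra S) (cuntz_endo S) ut) :
  let A := cuntz_algebra S in
  let alpha := cuntz_endo S in
  let AN := cstar_gen (with_gens A 'I_n) uN in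
  let AT := opalg_gen (with_gens A (seq 'I_n)) uT in
  let At := opalg_gen (with_gens A (seq 'I_n)) ut in
  let Atw := twisted_crossed (direct_limit A iota) t sigma U T in
  let pi' := fun x => tensor_op t (sigma (iota (0%N, x))) id in
  let T' := fun i => tensor_op t U (T i) in
  [/\ (* alpha is a unital injective *-endomorphism of A *)
      [/\ star_hom A A alpha, alpha id = id & set_inj A alpha],
      (* (a) *)
      exists Phi : (HN -> HN) -> (K -> K),
        [/\ star_hom AN Atw Phi,
            intertwines (with_gens A 'I_n) uN (pair_gens pi' T') Phi,
            set_surj AN Atw Phi &
            ~ set_inj AN Phi],
      (* (b) *)
      exists Phi : (HT -> HT) -> (K -> K),
        [/\ alg_hom AT Atw Phi,
            intertwines (with_gens A (seq 'I_n)) uT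
              (pair_gens pi' (word T')) Phi,
            completely_contractive AT Phi &
            ~ completely_isometric AT Phi] &
      (* (c) *)
      ~ exists Phi : (HT -> HT) -> (Ht -> Ht),
        [/\ alg_hom AT At Phi,
            intertwines (with_gens A (seq 'I_n)) uT ut Phi,
            set_bij AT At Phi &
            completely_isometric AT Phi]].
Proof.
move=> A alpha AN AT At Atw pi' T'.
have [[cS _] x0] := hS; have [[cT _] _] := hT.
have [ciota _] := hiota.
have [[sigma' [U' [hsigma hU hcov e]]] _] := hsigmaU.
(* Membership in the class yields some pair with the same generating family; evaluating the family
   at [inl x] and [inr tt] identifies it with sigma and U. *)
have es : sigma = sigma'.
  by apply/funext => x; exact: (congr1 (@^~ (inl x)) e).
have eU : U = U' by exact: (congr1 (@^~ (inr tt)) e).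
rewrite -es -eU in hsigma hU hcov.
split.
- split; [exact: cuntz_endo_star_hom|exact: cuntz_endo_id|].
  exact: cuntz_endo_inj cS (Ordinal hn).
(* [hn] reads 1 < n, so [Ordinal (ltnW hn)] and [Ordinal hn] are the distinct indices 0 and 1. *)
- apply: (@canonical_star_hom _ _ _ _ cS _ _ ciota _ halphainf _ _ _ hsigma hU
    hcov _ _ cT _ _ (Ordinal (ltnW hn)) (Ordinal hn)) => //.
- exact: (@canonical_alg_hom _ _ _ _ cS _ _ ciota _ halphainf).
move=> [Phi [hom itw _]].
exact: (semicrossed_not_isometric_tensor cS hn x0 huT hut.1 hom itw).
Qed.
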